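(* Let $n\ge 2$ and let $\Omega\subset\mathbb{R}^2$ be a simply connected domain. (a) Let $f=(f_1,\dots,f_n):\Omega\to\mathbb{R}^n$ be an area-decreasing map with area angle function $\Theta:\Omega\to(0,\frac{\pi}{2}]$ whose graph $\mathbf{\Phi}(x,y)=(x,y,f_1(x,y),\dots,f_n(x,y))$ is a minimal surface in $\mathbb{R}^{n+2}$. Then there exists an area-decreasing map $g=(g_1,\dots,g_n):\Omega\to\mathbb{R}^n$ with the same area angle function $\Theta$ whose graph $\widehat{\mathbf{\Phi}}(x,y)=(x,y,g_1(x,y),\dots,g_n(x,y))$ is a maximal surface in $\mathbb{R}^{n+2}_n$. (b) Conversely, let $g=(g_1,\dots,g_n):\Omega\to\mathbb{R}^n$ be an area-decreasing map with area angle function $\Theta:\Omega\to(0,\frac{\pi}{2}]$ whose graph $\widehat{\mathbf{\Phi}}$ is a maximal surface in $\mathbb{R}^{n+2}_n$. Then there exists an area-decreasing map $f=(f_1,\dots,f_n):\Omega\to\mathbb{R}^n$ with the same area angle function $\Theta$ whose graph $\mathbf{\Phi}$ is a minimal surface in $\mathbb{R}^{n+2}$. (c) The correspondences $\mathbf{\Phi}\Leftrightarrow\widehat{\mathbf{\Phi}}$ in (a) and (b) (the twin correspondence) fulfill the following properties. Write the induced metrics as $ds^2_{\mathbf{\Phi}}=E\,dx^2+2F\,dx\,dy+G\,dy^2$ and $ds^2_{\widehat{\mathbf{\Phi}}}=\widehat E\,dx^2+2\widehat F\,dx\,dy+\widehat G\,dy^2$, and $\omega=\sqrt{EG-F^2}$,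 $\widehat\omega=\sqrt{\widehat E\widehat G-\widehat F^2}$. (c1) The twin relations hold: for all $k\in\{1,\dots,n\}$, $$\left(\frac{\partial g_k}{\partial x},\frac{\partial g_k}{\partial y}\right)=\left(-\frac{E}{\omega}\frac{\partial f_k}{\partial y}+\frac{F}{\omega}\frac{\partial f_k}{\partial x},\ \frac{G}{\omega}\frac{\partial f_k}{\partial x}-\frac{F}{\omega}\frac{\partial f_k}{\partial y}\right)$$ and, equivalently, for all $k\in\{1,\dots,n\}$, $$\left(\frac{\partial f_k}{\partial x},\frac{\partial f_k}{\partial y}\right)=\left(\frac{\widehat E}{\widehat\omega}\frac{\partial g_k}{\partial y}-\frac{\widehat F}{\widehat\omega}\frac{\partial g_k}{\partial x},\ -\frac{\widehat G}{\widehat\omega}\frac{\partial g_k}{\partial x}+\frac{\widehat F}{\widehat\omega}\frac{\partial g_k}{\partial y}\right).$$ (c2) $f$ and $g$ have the same area angle function $\Theta$, and each Jacobian determinant is preserved: $\frac{\partial(f_i,f_j)}{\partial(x,y)}=\frac{\partial(g_i,g_j)}{\partial(x,y)}$ for all $i,j\in\{1,\dots,n\}$. (c3) The angle duality holds: $\widehat\omega\,\omega=\sin^2\Theta>0$. (c4) The two induced metrics are conformally equivalent: $ds^2_{\mathbf{\Phi}}=\frac{\omega}{\widehat\omega}\,ds^2_{\widehat{\mathbf{\Phi}}}$. (d) The twin correspondence is involutive: the twin minimal graph in $\mathbb{R}^{n+2}$ of the twin maximal graph of a minimal graph $\Sigma$ as in (a) is congruent to $\Sigma$ up to vertical translations (that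 is, up to adding constants to the height functions $f_1,\dots,f_n$).
   Context: $\mathbb{R}^{n+2}$ carries the Euclidean metric $dx_1^2+\cdots+dx_{n+2}^2$, and $\mathbb{R}^{n+2}_n$ denotes the space $\mathbb{R}^{n+2}$ with the pseudo-Euclidean metric $dx_1^2+dx_2^2-dx_3^2-\cdots-dx_{n+2}^2$. Maps are of class $C^2$. For $\phi=(\phi_1,\dots,\phi_n):\Omega\to\mathbb{R}^n$ put $\mathcal{J}_{i,j}=\frac{\partial(\phi_i,\phi_j)}{\partial(x,y)}$ (the Jacobian determinant) and $\Vert\mathcal{J}\Vert=\sqrt{\sum_{1\le i<j\le n}\mathcal{J}_{i,j}^2}$. The map $\phi$ is area-decreasing if $\Vert\mathcal{J}\Vert<1$ on $\Omega$; its area angle function is then $\Theta_\phi=\cos^{-1}(\Vert\mathcal{J}\Vert)\in(0,\frac{\pi}{2}]$. A minimal surface in $\mathbb{R}^{n+2}$ is a surface with zero mean curvature vector; the graph $\mathbf{\Phi}$ of $f$ is minimal if and only if $G\frac{\partial^2 f_k}{\partial x^2}-2F\frac{\partial^2 f_k}{\partial x\partial y}+E\frac{\partial^2 f_k}{\partial y^2}=0$ for all $k$, where $E=1+\sum_k(\partial_x f_k)^2$, $F=\sum_k\partial_x f_k\,\partial_y f_k$, $G=1+\sum_k(\partial_y f_k)^2$. A maximal surface in $\mathbb{R}^{n+2}_n$ is a spacelike surface (positive definite induced metric) with zero mean curvature vector; a spacelike graph $\widehat{\mathbf{\Phi}}$ of $g$ is maximal if and only if $\widehat G\frac{\partial^2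 g_k}{\partial x^2}-2\widehat F\frac{\partial^2 g_k}{\partial x\partial y}+\widehat E\frac{\partial^2 g_k}{\partial y^2}=0$ for all $k$, where $\widehat E=1-\sum_k(\partial_x g_k)^2$, $\widehat F=-\sum_k\partial_x g_k\,\partial_y g_k$, $\widehat G=1-\sum_k(\partial_y g_k)^2$, and $\widehat E\widehat G-\widehat F^2>0$. *)

(* Defs.v *)
From HB Require Import structures.
From mathcomp Require Import all_boot all_order all_algebra.
From mathcomp Require Import all_classical all_reals all_analysis.
Set Implicit Arguments.
Unset Strict Implicit.
Unset Printing Implicit Defensive.
Import Order.TTheory GRing.Theory Num.Theory numFieldNormedType.Exports.
Local Open Scope classical_set_scope.
Local Open Scope ring_scope.

(* Maps on a planar domain Omega are total functions on the plane; every
   condition below only concerns their values on the (open) set Omega. *)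

Section Domain.
Context {R : realType}.

(* Loops and homotopies are total functions constrained on [0, 1] and
   [0, 1] x [0, 1]; in [h (s, t)], [s] is the deformation parameter. The
   base point is fixed during the deformation. *)
Definition null_homotopic_in (A : set (R * R)) (c : R -> R * R) : Prop :=
  exists h : R * R -> R * R,
    [/\ {within `[0, 1] `*` `[0, 1], continuous h},
        forall s t : R, 0 <= s <= 1 -> 0 <= t <= 1 -> A (h (s, t)),
        forall t : R, 0 <= t <= 1 -> h (0, t) = c t,
        forall t : R, 0 <= t <= 1 -> h (1, t) = c 0 &
        forall s : R, 0 <= s <= 1 -> h (s, 0) = c 0 /\ h (s, 1) = c 0].

Definition simply_connected_domain (A : set (R * R)) : Prop :=
  [/\ open A, A !=set0, connected A &
      forall c : R -> R * R,
        {within `[0, 1], continuous c} ->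
        (forall t : R, 0 <= t <= 1 -> A (c t)) ->
        c 0 = c 1 -> null_homotopic_in A c].

End Domain.

Section Calculus.
Context {R : realType} {V : normedModType R}.

Definition dx (u : R * R -> V) (p : R * R) : V := 'D_((1, 0) : R * R) u p.
Definition dy (u : R * R -> V) (p : R * R) : V := 'D_((0, 1) : R * R) u p.

Definition C1_on (A : set (R * R)) (u : R * R -> V) : Prop :=
  forall p, A p ->
    [/\ derivable u p ((1, 0) : R * R), derivable u p ((0, 1) : R * R),
        {for p, continuous (dx u)} & {for p, continuous (dy u)}].

Definition C2_on (A : set (R * R)) (u : R * R -> V) : Prop :=
  [/\ C1_on A u, C1_on A (dx u) & C1_on A (dy u)].

End Calculus.

Section ParametricSurfaces.
Context {R : realType} {m : nat}.

(* The pseudo-Euclidean form [\sum_i s i * dx_i ^ 2]. *)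
Definition mdot (s : 'I_m -> R) (u v : 'rV[R]_m) : R :=
  \sum_(i < m) s i * u 0 i * v 0 i.

Variables (s : 'I_m -> R) (X : R * R -> 'rV[R]_m) (p : R * R).

Definition ffE : R := mdot s (dx X p) (dx X p).
Definition ffF : R := mdot s (dx X p) (dy X p).
Definition ffG : R := mdot s (dy X p) (dy X p).
Definition gram : R := ffE * ffG - ffF ^+ 2.
Definition area_element : R := Num.sqrt gram.

Definition induced_metric (v : R * R) : R :=
  ffE * v.1 ^+ 2 + 2 * ffF * v.1 * v.2 + ffG * v.2 ^+ 2.

(* The coefficients of the tangential part solve the 2 x 2 Gram system given
   by the products of [w] with [dx X p] and [dy X p]. *)
Definition normal_part (w : 'rV[R]_m) : 'rV[R]_m :=
  let a := mdot s w (dx X p) in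
  let b := mdot s w (dy X p) in
  w - ((ffG * a - ffF * b) / gram) *: dx X p
    - ((ffE * b - ffF * a) / gram) *: dy X p.

(* Half the trace, with respect to the induced metric, of the second
   fundamental form. *)
Definition mean_curvature_vector : 'rV[R]_m :=
  (2 * gram)^-1 *:
    (ffG *: normal_part (dx (dx X) p)
     - (2 * ffF) *: normal_part (dx (dy X) p)
     + ffE *: normal_part (dy (dy X) p)).

End ParametricSurfaces.

Section MinimalAndMaximalSurfaces.
Context {R : realType}.

Definition zero_mean_curvature_surface (m : nat) (s : 'I_m -> R)
    (A : set (R * R)) (X : R * R -> 'rV[R]_m) : Prop :=
  [/\ C2_on A X,
      forall p, A p -> forall v : R * R, v != 0 -> 0 < induced_metric s X p v &
      forall p, A p -> mean_curvature_vector s X p = 0].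

Definition euclidean_sig (n : nat) (i : 'I_(2 + n)) : R := 1.
Definition pseudo_sig (n : nat) (i : 'I_(2 + n)) : R :=
  if (i < 2)%N then 1 else -1.

Definition minimal_surface (n : nat) :=
  zero_mean_curvature_surface (@euclidean_sig n).
Definition maximal_surface (n : nat) :=
  zero_mean_curvature_surface (@pseudo_sig n).

End MinimalAndMaximalSurfaces.

Section Graphs.
Context {R : realType} {n : nat}.
Implicit Types (f g : R * R -> 'rV[R]_n) (p : R * R) (A : set (R * R)).

Definition graph_map f p : 'rV[R]_(2 + n) :=
  row_mx (\row_(i < 2) (if i == 0 then p.1 else p.2)) (f p).

Definition component f (k : 'I_n) p : R := f p 0 k.

Definition jacobian_det f (i j : 'I_n) p : R :=
  dx (component f i) p * dy (component f j) p - dy (component f i) p * dx (component f j) p.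

Definition jacobian_norm f p : R :=
  Num.sqrt (\sum_(i < n) \sum_(j < n | (i < j)%N) jacobian_det f i j p ^+ 2).

Definition area_decreasing A f : Prop :=
  C2_on A f /\ (forall p, A p -> jacobian_norm f p < 1).

Definition area_angle f p : R := acos (jacobian_norm f p).

Definition is_area_angle A f (Theta : R * R -> R) : Prop :=
  forall p, A p -> 0 < Theta p <= pi / 2 /\ Theta p = area_angle f p.

Definition twin_relations A f g : Prop :=
  forall p, A p -> forall k : 'I_n,
    let s := @euclidean_sig R n in
    let E := ffE s (graph_map f) p in
    let F := ffF s (graph_map f) p in
    let G := ffG s (graph_map f) p in
    let w := area_element s (graph_map f) p in
    dx (component g k) p =
      - (E / w) * dy (component f k) p + F / w * dx (component f k) p /\
    dy (component g k) p =
      G / w * dx (component f k) p - F / w * dy (component f k) p.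

Definition inverse_twin_relations A f g : Prop :=
  forall p, A p -> forall k : 'I_n,
    let s := @pseudo_sig R n in
    let E := ffE s (graph_map g) p in
    let F := ffF s (graph_map g) p in
    let G := ffG s (graph_map g) p in
    let w := area_element s (graph_map g) p in
    dx (component f k) p =
      E / w * dy (component g k) p - F / w * dx (component g k) p /\
    dy (component f k) p =
      - (G / w) * dx (component g k) p + F / w * dy (component g k) p.

Definition twin_maximal_graph A f g : Prop :=
  [/\ area_decreasing A g, maximal_surface A (graph_map g) &
      twin_relations A f g].

Definition twin_minimal_graph A g f : Prop :=
  [/\ area_decreasing A f, minimal_surface A (graph_map f) &
      inverse_twin_relations A f g].

End Graphs.

(* Main.v *)
Require Import Defs.
From HB Require Import structures.
From mathcomp Require Import all_boot all_order all_algebra.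
From mathcomp Require Import all_classical all_reals all_analysis.
From mathcomp Require Import ring lra.
Set Implicit Arguments.
Unset Strict Implicit.
Unset Printing Implicit Defensive.
Import Order.TTheory GRing.Theory Num.Theory numFieldNormedType.Exports.
Local Open Scope classical_set_scope.
Local Open Scope ring_scope.

(** Minimal graphs and maximal graphs are treated together, by means of a sign
    [eps] (1 or -1) and the signature (1, 1, eps, ..., eps). Let [E], [F], [G]
    be the coefficients of the induced metric of the graph of [f], so that
    [E = 1 + eps |f_x|^2] and so on, let [w = sqrt (E G - F^2)], and put
    [a = E / w], [b = F / w], [c = G / w]; thus [a c - b^2 = 1].

    The second derivatives of a graph are vertical, hence its mean curvature
    vanishes if and only if [c f_xx - 2 b f_xy + a f_yy = 0] for every component
    ([zero_mean_curvature_graphP]). Contracting this equation with the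
    gradients of the components gives [c_x = b_y] and [a_y = b_x]
    ([conformal_coefficients]): the two horizontal coordinates are harmonic for
    the induced metric. Consequently the 1-form
    [- eps (a f_y - b f_x) dx + eps (c f_x - b f_y) dy] is closed, and on a simply
    connected domain it is the differential of a function [g]; this is the
    twin ([exists_twin]).

    The rest is algebra at a point. The linear map that sends the gradient of
    [f] to that of [g] has determinant 1, so all Jacobian determinants agree.
    With [D = 1 - |J|^2], which is positive for an area-decreasing map, the
    induced metric of [g] for the sign [- eps] is [D / w^2] times that of [f]
    ([twin_first_form]). So it is positive definite and conformal to that of [f],
    its area element is [D / w], and the coefficients [a], [b], [c] are the same
    for [f] and [g]. Therefore the twin relations invert into the twin relations
    for [- eps] ([twin_sym]). They can be written [c g_x - b g_y = - eps f_y] and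
    [a g_y - b g_x = eps f_x], whose divergence is zero because the mixed second
    derivatives of [f] cancel; this is the zero mean curvature equation for [g]
    ([twin_operator_eq0]). Finally, two twins of the same map have the same
    gradient and differ by a constant on a connected domain.

    The existence of global potentials has to be derived from homotopies that
    are only continuous, along which a 1-form cannot be integrated. A line
    integral is replaced by a finite sum of increments of local potentials
    along a chain of points such that consecutive ones lie in a common square
    ([increment], [chain]). A fine grid on a homotopy shows that the sum along
    a null-homotopic loop is zero ([null_homotopic_sum]), hence the value of a
    chain depends only on its ends ([chain_value_unique]), and the values of
    the chains that start at a base point define the potential
    ([global_potential]). *)

(** * C1 functions of two variables, with explicit partial derivatives *)

Section DifferentiableFunctions.
Context {R : realType}.
Implicit Types (A : set (R * R)) (u v ux uy vx vy : R * R -> R).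

(** The partial derivatives are carried as explicit functions because [dx u] and
    [dy u] have a closed form on [A] only. Continuity of [u] is part of the
    predicate: the product rule needs it to keep the derivatives continuous. *)
Definition has_C1_partials A u ux uy : Prop := forall p, A p ->
  [/\ {for p, continuous u},
      is_derive p ((1, 0) : R * R) u (ux p),
      is_derive p ((0, 1) : R * R) u (uy p),
      {for p, continuous ux} & {for p, continuous uy}].

Lemma open_near A p : open A -> A p -> \forall q \near p, A q.
Proof. by move=> oA Ap; apply: open_nbhs_nbhs. Qed.

Lemma near_eq_cont (T : topologicalType) (u v : R * R -> T) p :
  (\forall q \near p, u q = v q) ->
  {for p, continuous u} -> {for p, continuous v}.
Proof.
move=> uv uc; have uvp := nbhs_singleton uv.
rewrite /prop_for /continuous_at -uvp.
by apply: cvg_trans uc; exact: near_eq_cvg.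
Qed.

Lemma has_C1_partialsE A u ux uy : has_C1_partials A u ux uy ->
  forall p, A p -> dx u p = ux p /\ dy u p = uy p.
Proof. by move=> H p /H[_ [_ <-] [_ <-]]. Qed.

Lemma has_C1_partials_C1_on A u ux uy : open A -> has_C1_partials A u ux uy ->
  C1_on A u.
Proof.
move=> oA H p Ap; have [_ [dux _] [duy _] cx cy] := H p Ap.
split; [exact: dux|exact: duy| |].
- apply: near_eq_cont cx; near=> q; apply/esym.
  by have /(has_C1_partialsE H)[] : A q by near: q; exact: open_near.
- apply: near_eq_cont cy; near=> q; apply/esym.
  by have /(has_C1_partialsE H)[] : A q by near: q; exact: open_near.
Unshelve. all: by end_near. Qed.

Lemma C1_on_has_C1_partials A u : C1_on A u ->
  (forall p, A p -> {for p, continuous u}) ->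
  has_C1_partials A u (dx u) (dy u).
Proof.
move=> H uc p Ap; have [ux uy cx cy] := H p Ap.
by split; [exact: uc|exact: DeriveDef|exact: DeriveDef|exact: cx|exact: cy].
Qed.

Lemma has_C1_partials_eq A u v ux uy vx vy : open A ->
  (forall p, A p -> u p = v p) -> (forall p, A p -> ux p = vx p) ->
  (forall p, A p -> uy p = vy p) ->
  has_C1_partials A u ux uy -> has_C1_partials A v vx vy.
Proof.
move=> oA uv uvx uvy H p Ap; have [cu du1 du2 cx cy] := H p Ap.
have n (f g : R * R -> R) : (forall q, A q -> f q = g q) ->
    \forall q \near p, f q = g q.
  by move=> fg; near=> q; apply: fg; near: q; exact: open_near.
split.
- by apply: near_eq_cont cu; exact: n.
- by rewrite -uvx//; apply: near_eq_is_derive du1; exact: n.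
- by rewrite -uvy//; apply: near_eq_is_derive du2; exact: n.
- by apply: near_eq_cont cx; exact: n.
- by apply: near_eq_cont cy; exact: n.
Unshelve. all: by end_near. Qed.

Lemma has_C1_partials_cst A (k : R) :
  has_C1_partials A (fun=> k) (fun=> 0) (fun=> 0).
Proof.
by move=> p _; split; [exact: cst_continuous|exact: is_derive_cst..
  |exact: cst_continuous|exact: cst_continuous].
Qed.

Lemma has_C1_partialsD A u ux uy v vx vy :
  has_C1_partials A u ux uy -> has_C1_partials A v vx vy ->
  has_C1_partials A (fun p => u p + v p) (fun p => ux p + vx p)
    (fun p => uy p + vy p).
Proof.
move=> H K p Ap; have [? ? ? ? ?] := H p Ap; have [? ? ? ? ?] := K p Ap.
by split; [exact: continuousD|exact: is_deriveD|exact: is_deriveD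
  |exact: continuousD|exact: continuousD].
Qed.

Lemma has_C1_partialsM A u ux uy v vx vy :
  has_C1_partials A u ux uy -> has_C1_partials A v vx vy ->
  has_C1_partials A (fun p => u p * v p)
    (fun p => ux p * v p + u p * vx p) (fun p => uy p * v p + u p * vy p).
Proof.
move=> H K p Ap; have [? ? ? ? ?] := H p Ap; have [? ? ? ? ?] := K p Ap.
split.
- exact: continuousM.
- by apply: is_derive_eq; rewrite addrC; congr (_ + _); rewrite mulrC.
- by apply: is_derive_eq; rewrite addrC; congr (_ + _); rewrite mulrC.
- by apply: continuousD; exact: continuousM.
- by apply: continuousD; exact: continuousM.
Qed.

Lemma has_C1_partials_sum A (n : nat) (u ux uy : 'I_n -> R * R -> R) :
  (forall i, has_C1_partials A (u i) (ux i) (uy i)) ->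
  has_C1_partials A (fun p => \sum_i u i p) (fun p => \sum_i ux i p)
    (fun p => \sum_i uy i p).
Proof.
elim: n u ux uy => [|n IH] u ux uy H.
  have e (w : 'I_0 -> R * R -> R) : (fun p => \sum_i w i p) = fun=> 0.
    by apply/funext => p; rewrite big_ord0.
  by rewrite !e; exact: has_C1_partials_cst.
have e (w : 'I_n.+1 -> R * R -> R) : (fun p => \sum_i w i p) =
    fun p => w ord0 p + \sum_i w (lift ord0 i) p.
  by apply/funext => p; rewrite big_ord_recl.
rewrite !e.
apply: has_C1_partialsD; first exact: H.
exact: (IH (fun i => u (lift ord0 i))).
Qed.

(** Directional derivatives are derivatives of functions of one real variable,
    which gives access to the one-variable chain rule. *)
Lemma is_derive_section u p (d : R * R) (du : R) : is_derive p d u du <->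
  is_derive (0 : R) (1 : R) (fun h : R => u (h *: d + p)) du.
Proof.
have e : 'D_1 (fun h : R => u (h *: d + p)) 0 = 'D_d u p.
  rewrite /derive; set g1 := fun h => h^-1 *: _; set g2 := fun h => h^-1 *: _.
  suff -> : g1 = g2 by [].
  by rewrite funeqE /g1 /g2 => h /=; rewrite addr0 scale0r add0r [_%:A]mulr1.
split=> -[ud <-].
  by split; [exact: ((derivable1P u p d).1 ud)|exact: e].
by split; [exact: ((derivable1P u p d).2 ud)|rewrite e].
Qed.

Lemma is_derive_compR u p d (du : R) (h : R -> R) (dh : R) :
  is_derive (u p) 1 h dh -> is_derive p d u du ->
  is_derive p d (fun q => h (u q)) (dh * du).
Proof.
move=> H /is_derive_section K; apply/is_derive_section.
apply: (@is_derive1_comp _ h (fun t : R => u (t *: d + p))) => //.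
by rewrite scale0r add0r.
Qed.

Lemma has_C1_partials_sqrt A u ux uy : (forall p, A p -> 0 < u p) ->
  has_C1_partials A u ux uy ->
  has_C1_partials A (fun p => Num.sqrt (u p))
    (fun p => (2 * Num.sqrt (u p))^-1 * ux p)
    (fun p => (2 * Num.sqrt (u p))^-1 * uy p).
Proof.
move=> u0 H p Ap; have [? ? ? ? ?] := H p Ap.
have cs : {for p, continuous (fun q => Num.sqrt (u q))}.
  by apply: (@continuous_comp _ _ _ u Num.sqrt) => //; exact: sqrt_continuous.
have s0 : 2 * Num.sqrt (u p) != 0.
  by rewrite mulf_neq0// gt_eqF// sqrtr_gt0 u0.
have ci : {for p, continuous (fun q => (2 * Num.sqrt (u q))^-1)}.
  by apply: continuousV => //; apply: continuousM => //; exact: cst_continuous.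
have ds := is_derive1_sqrt (u0 _ Ap).
split => //.
- exact: is_derive_compR.
- exact: is_derive_compR.
- exact: continuousM.
- exact: continuousM.
Qed.

Lemma has_C1_partialsV A u ux uy : (forall p, A p -> u p != 0) ->
  has_C1_partials A u ux uy ->
  has_C1_partials A (fun p => (u p)^-1)
    (fun p => - (u p ^- 2 * ux p)) (fun p => - (u p ^- 2 * uy p)).
Proof.
move=> u0 H p Ap; have [? ? ? ? ?] := H p Ap.
have cV : {for p, continuous (fun q => (u q ^+ 2)^-1)}.
  by apply: continuousV; [rewrite expf_neq0// u0|exact: continuousM].
have dV : is_derive (u p) 1 (fun t : R => t^-1) (- u p ^- 2).
  have := @is_deriveV _ id (u p) 1 1 (u0 p Ap) (is_derive_id _ _).
  by rewrite /GRing.scale/= mulr1.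
split.
- by apply: continuousV => //; exact: u0.
- rewrite -mulNr; exact: is_derive_compR.
- rewrite -mulNr; exact: is_derive_compR.
- by apply: continuousN; exact: continuousM.
- by apply: continuousN; exact: continuousM.
Qed.

End DifferentiableFunctions.

(** * Integrals with a parameter *)

Section Rectangles.
Context {R : realType}.
Implicit Types (u : R * R -> R).
Notation mu := (@lebesgue_measure R).

Lemma is_derive_xP u x y du :
  is_derive (x, y) ((1, 0) : R * R) u du <->
  is_derive x (1 : R) (fun t => u (t, y)) du.
Proof.
have e : (fun h : R => h^-1 *: (u (h *: ((1, 0) : R * R) + (x, y)) - u (x, y)))
    = fun h => h^-1 *: (u (h *: (1 : R) + x, y) - u (x, y)).
  apply/funext => h; congr (_ *: (u _ - _)).
  by rewrite /GRing.add/= /add_pair/= /GRing.scale/= mulr0 add0r.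
have ed : derivable u (x, y) ((1, 0) : R * R) = derivable (fun t => u (t, y)) x 1.
  by rewrite /derivable e.
have ev : 'D_((1, 0) : R * R) u (x, y) = 'D_1 (fun t => u (t, y)) x by rewrite /derive e.
split=> -[ud <-].
  by split; [rewrite -ed; exact: ud|rewrite ev].
by split; [rewrite ed; exact: ud|rewrite ev].
Qed.

Lemma is_derive_yP u x y du :
  is_derive (x, y) ((0, 1) : R * R) u du <->
  is_derive y (1 : R) (fun t => u (x, t)) du.
Proof.
have e : (fun h : R => h^-1 *: (u (h *: ((0, 1) : R * R) + (x, y)) - u (x, y)))
    = fun h => h^-1 *: (u (x, h *: (1 : R) + y) - u (x, y)).
  apply/funext => h; congr (_ *: (u _ - _)).
  by rewrite /GRing.add/= /add_pair/= /GRing.scale/= mulr0 add0r.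
have ed : derivable u (x, y) ((0, 1) : R * R) = derivable (fun t => u (x, t)) y 1.
  by rewrite /derivable e.
have ev : 'D_((0, 1) : R * R) u (x, y) = 'D_1 (fun t => u (x, t)) y by rewrite /derive e.
split=> -[ud <-].
  by split; [rewrite -ed; exact: ud|rewrite ev].
by split; [rewrite ed; exact: ud|rewrite ev].
Qed.

Lemma is_derive_cont (f : R -> R) x df : is_derive x (1 : R) f df ->
  {for x, continuous f}.
Proof. by case=> /derivable1_diffP/differentiable_continuous. Qed.

Lemma cont_pair (T U V : topologicalType) (f : T -> U) (g : T -> V) x :
  {for x, continuous f} -> {for x, continuous g} ->
  {for x, continuous (fun t => (f t, g t))}.
Proof. by move=> fc gc; apply: (cvg_pair fc gc). Qed.

Lemma cont_pairl u x y : {for (x, y), continuous u} ->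
  {for x, continuous (fun t => u (t, y))}.
Proof.
move=> uc; apply: (@continuous_comp _ _ _ (fun t => (t, y)) u) => //.
by apply: cont_pair; [exact: cvg_id|exact: cvg_cst].
Qed.

Lemma cont_pairr u x y : {for (x, y), continuous u} ->
  {for y, continuous (fun t => u (x, t))}.
Proof.
move=> uc; apply: (@continuous_comp _ _ _ (fun t => (x, t)) u) => //.
by apply: cont_pair; [exact: cvg_cst|exact: cvg_id].
Qed.

Lemma within_cont (T U : topologicalType) (A : set T) (f : T -> U) :
  (forall x, A x -> {for x, continuous f}) -> {within A, continuous f}.
Proof. by move=> h; apply: continuous_in_subspaceT => x /set_mem/h. Qed.

Lemma integrable_cont (f : R -> R) a b :
  (forall x, a <= x <= b -> {for x, continuous f}) ->
  mu.-integrable `[a, b] (EFin \o f).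
Proof.
move=> fc; apply: continuous_compact_integrable; first exact: segment_compact.
by apply: within_cont => x /=; rewrite in_itv/=; exact: fc.
Qed.

Lemma FTC1_right (f : R -> R) a x b : a < x < b ->
  (forall t, a <= t <= b -> {for t, continuous f}) ->
  is_derive x (1 : R) (fun y => \int[mu]_(t in `[a, y]) f t)%R (f x).
Proof.
move=> /andP[ax xb] fc.
have fi := integrable_cont fc.
have fx : {for x, continuous f} by apply: fc; rewrite !ltW.
have [d1 d2] := continuous_FTC1_closed xb fi ax fx.
by split; [exact: d1|rewrite -derive1E].
Qed.

(** Near [x] the derivative of the integrand is bounded on a compact rectangle,
    so that dominated convergence applies. *)
Lemma derive_under_integral (Q Qx : R * R -> R) (a b c d : R) x :
  a < x < b ->
  (forall s t, a < s < b -> c <= t <= d ->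
    [/\ is_derive (s, t) ((1, 0) : R * R) Q (Qx (s, t)),
        {for t, continuous (fun t => Q (s, t))} &
        {for (s, t), continuous Qx}]) ->
  is_derive x (1 : R) (fun s => \int[mu]_(t in `[c, d]) Q (s, t))%R
    (\int[mu]_(t in `[c, d]) Qx (x, t))%R.
Proof.
move=> /andP[ax xb] H.
pose u := (a + x) / 2; pose v := (x + b) / 2.
have au : a < u by rewrite /u; lra.
have ux : u < x by rewrite /u; lra.
have xv : x < v by rewrite /v; lra.
have vb : v < b by rewrite /v; lra.
have [M Mbound] : exists M, forall s t, u <= s <= v -> c <= t <= d ->
    `|Qx (s, t)| <= M.
  have : compact (Qx @` (`[u, v] `*` `[c, d])).
    apply: continuous_compact.
      apply: within_cont => -[s t] [/=]; rewrite !in_itv/= => /andP[us sv] ct.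
      have sab : a < s < b by rewrite (lt_le_trans au us) (le_lt_trans sv vb).
      by have [] := H s t sab ct.
    by apply: compact_setX; exact: segment_compact.
  move=> /compact_bounded[M [_ /(_ (M + 1))]].
  rewrite ltrDl => /(_ ltr01) h; exists (M + 1) => s t us ct.
  by apply: h; exists (s, t) => //; split; rewrite /= in_itv.
pose G (y : R) := Num.max 0 M.
have intG : mu.-integrable `[c, d] (EFin \o G).
  by apply: integrable_cont => ? _; exact: cvg_cst.
have uvab s : `]u, v[%classic s -> a < s < b.
  by rewrite /= in_itv/= => /andP[us sv]; rewrite (lt_trans au us) (lt_trans sv).
have Ix : `]u, v[%classic x by rewrite /= in_itv/= ux xv.
have mcd : measurable (`[c, d]%classic : set (measurableTypeR R)).
  exact: measurable_itv.
have intf s : `]u, v[%classic s ->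
    mu.-integrable `[c, d] (EFin \o (fun t => Q (s, t))).
  by move=> /uvab sab; apply: integrable_cont => t ct; have [] := H s t sab ct.
have dQ s t : a < s < b -> c <= t <= d ->
    is_derive s (1 : R) (fun s => Q (s, t)) (Qx (s, t)).
  by move=> sab ct; have [/is_derive_xP] := H s t sab ct.
have derf s t : `]u, v[%classic s -> `[c, d]%classic t ->
    derivable (fun s => Q (s, t)) s 1.
  move=> /uvab sab; rewrite /= in_itv/= => ct.
  by have [] := dQ s t sab ct.
have Gub s t : `]u, v[%classic s -> `[c, d]%classic t ->
    `|partial1of2 (fun s t => Q (s, t)) s t| <= G t.
  move=> Is; rewrite /= in_itv/= => ct; rewrite partial1of2E.
  have [_ ->] := dQ s t (uvab _ Is) ct.
  rewrite /G le_max Mbound ?orbT//.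
  by move: Is; rewrite /= in_itv/= => /andP[? ?]; rewrite !ltW.
have G0 t : 0 <= G t by rewrite /G le_max lexx.
have D1 := @derivable_under_integral _ _ _ mu (fun s t => Q (s, t)) _ mcd
  x u v Ix intf derf G G0 intG Gub.
have D2 := @differentiation_under_integral _ _ _ mu (fun s t => Q (s, t)) _ mcd
  x u v Ix intf derf G G0 intG Gub.
split; first exact: D1.
rewrite -derive1E D2; apply: eq_Rintegral => t.
rewrite inE/= in_itv/= => ct; rewrite partial1of2E.
by have [_ ->] := dQ x t (uvab _ Ix) ct.
Qed.

Lemma FTC2_cont (f F : R -> R) (a b : R) : a <= b ->
  (forall t, a <= t <= b -> is_derive t (1 : R) F (f t)) ->
  (forall t, a <= t <= b -> {for t, continuous f}) ->
  (\int[mu]_(t in `[a, b]) f t)%R = F b - F a.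
Proof.
rewrite le_eqVlt => /predU1P[->|ab] dF cf.
  by rewrite set_itv1 Rintegral_set1 subrr.
have cF t : a <= t <= b -> {for t, continuous F}.
  by move=> /dF; exact: is_derive_cont.
rewrite /Rintegral (@continuous_FTC2 _ f F)//.
- by apply: within_cont => x /=; rewrite in_itv/=; exact: cf.
- split.
  + by move=> t /[!in_itv]/= /andP[at_ tb]; have [] := dF t; rewrite ?ltW//.
  + by apply: cvg_at_right_filter; apply: cF; rewrite lexx ltW.
  + by apply: cvg_at_left_filter; apply: cF; rewrite lexx ltW.
- move=> t /[!in_itv]/= /andP[at_ tb]; rewrite derive1E.
  by have [|_ ->] := dF t; rewrite ?ltW.
Qed.

End Rectangles.

(** * Closed forms on squares and symmetry of second derivatives *)

Section LocalPotential.
Context {R : realType}.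
Implicit Types (A B : set (R * R)) (u P Q : R * R -> R).
Notation mu := (@lebesgue_measure R).

Lemma ball_planeE (z p : R * R) (r : R) : ball z r p <->
  (z.1 - r < p.1 < z.1 + r) /\ (z.2 - r < p.2 < z.2 + r).
Proof.
have e (x y : R) : ball x r y <-> x - r < y < x + r.
  by rewrite /ball/= -ltr_distl distrC; split.
by split=> [[/e ? /e ?]|[/e ? /e ?]]; split.
Qed.

Lemma open_ball_sub A z : open A -> A z ->
  exists2 r : R, 0 < r & ball z r `<=` A.
Proof.
move=> oA Az; have /nbhs_ballP[r r0 rA] : nbhs z A by exact: open_nbhs_nbhs.
by exists r.
Qed.

Definition is_potential A P Q u : Prop := forall p, A p ->
  is_derive p ((1, 0) : R * R) u (P p) /\ is_derive p ((0, 1) : R * R) u (Q p).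

(** The potential integrates [P] along a horizontal side and then [Q] along a
    vertical one. Its derivative in [y] is [Q] at once; in the derivative in [x],
    closedness turns the integral of [Qx] into a difference of values of [P]. *)
Lemma local_potential A P Px Py Q Qx Qy : open A ->
  has_C1_partials A P Px Py -> has_C1_partials A Q Qx Qy ->
  (forall p, A p -> Py p = Qx p) ->
  forall z, A z -> exists r : R, [/\ 0 < r, ball z r `<=` A &
    exists u, is_potential (ball z r) P Q u].
Proof.
move=> oA HP HQ PQ z Az.
have [r r0 rA] := open_ball_sub oA Az.
have r2 : r / 2 < r by rewrite ltr_pdivrMr// ltr_pMr// ltr1n.
exists (r / 2); split; first by rewrite divr_gt0.
  by apply: subset_trans rA; apply: le_ball; exact: ltW.
(* The base point is the corner of the smaller square, so that each of its
   points lies strictly above and to the right of it; [A] contains the larger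
   square, hence the closed sides of the smaller one. *)
pose a := z.1 - r / 2; pose c := z.2 - r / 2.
exists (fun p => (\int[mu]_(s in `[a, p.1]) P (s, c) +
                  \int[mu]_(t in `[c, p.2]) Q (p.1, t))%R).
have inA s t : a <= s < z.1 + r -> c <= t < z.2 + r -> A (s, t).
  rewrite /a /c => /andP[as_ sr] /andP[ct tr]; apply: rA.
  by apply/ball_planeE => /=; split; apply/andP; split => //; lra.
move=> -[x y] /ball_planeE/= [/andP[ax xr] /andP[cy yr]].
have axr : a <= x < z.1 + r by rewrite ltW//=; lra.
have cyr : c <= y < z.2 + r by rewrite ltW//=; lra.
have ccr : c <= c < z.2 + r by rewrite lexx/=; lra.
have Qc s t : a <= s < z.1 + r -> c <= t < z.2 + r ->
    {for t, continuous (fun t => Q (s, t))}.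
  by move=> sA tA; have [/cont_pairr] := HQ _ (inA _ _ sA tA).
have Pc s t : a <= s < z.1 + r -> c <= t < z.2 + r ->
    {for s, continuous (fun s => P (s, t))}.
  by move=> sA tA; have [/cont_pairl] := HP _ (inA _ _ sA tA).
split.
- apply/is_derive_xP => /=.
  have I1 : is_derive x (1 : R) (fun s => \int[mu]_(s in `[a, s]) P (s, c))%R
      (P (x, c)).
    apply: (@FTC1_right _ (fun s => P (s, c)) _ _ ((x + (z.1 + r)) / 2)).
      by rewrite ax/=; lra.
    by move=> t /andP[at_ tr]; apply: Pc => //; rewrite at_/=; lra.
  have I2 : is_derive x (1 : R) (fun s => \int[mu]_(t in `[c, y]) Q (s, t))%R
      (\int[mu]_(t in `[c, y]) Qx (x, t))%R.
    apply: (@derive_under_integral _ Q Qx a (z.1 + r)); first by rewrite ax/=; lra.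
    move=> s t /andP[sa sr] /andP[tc ty].
    have sA : a <= s < z.1 + r by rewrite ltW.
    have tA : c <= t < z.2 + r by rewrite tc/=; lra.
    have [_ d1 _ ? _] := HQ _ (inA _ _ sA tA).
    by split; [exact: d1|exact: Qc|].
  have I3 : (\int[mu]_(t in `[c, y]) Qx (x, t))%R = P (x, y) - P (x, c).
    apply: (@FTC2_cont _ (fun t => Qx (x, t)) (fun t => P (x, t))).
    - by case/andP: cyr.
    - move=> t /andP[tc ty].
      have tA : c <= t < z.2 + r by rewrite tc/=; lra.
      rewrite -PQ; last exact: inA.
      by apply/is_derive_yP; have [] := HP _ (inA _ _ axr tA).
    - move=> t /andP[tc ty].
      have tA : c <= t < z.2 + r by rewrite tc/=; lra.
      by have [_ _ _ /cont_pairr] := HQ _ (inA _ _ axr tA).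
  have := is_deriveD I1 I2.
  by rewrite I3 addrCA subrr addr0.
- apply/is_derive_yP => /=.
  have I2 : is_derive y (1 : R) (fun y => \int[mu]_(t in `[c, y]) Q (x, t))%R
      (Q (x, y)).
    apply: (@FTC1_right _ (fun t => Q (x, t)) _ _ ((y + (z.2 + r)) / 2)).
      by rewrite cy/=; lra.
    by move=> t /andP[at_ tr]; apply: Qc => //; rewrite at_/=; lra.
  have := is_deriveD (is_derive_cst (\int[mu]_(s in `[a, x]) P (s, c))%R y 1) I2.
  by rewrite add0r.
Qed.

(** Differentiating [u (x, t) - u (x, c)], the integral of [uy] from [c] to [t],
    with respect to [x] shows that [ux (x, t) - ux (x, c)] is the integral of
    [uyx]; it remains to differentiate with respect to [t]. *)
Lemma symmetry_of_second_partials A u ux uy uxx uxy uyx uyy : open A ->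
  is_potential A ux uy u ->
  has_C1_partials A ux uxx uxy -> has_C1_partials A uy uyx uyy ->
  forall z, A z -> uxy z = uyx z.
Proof.
move=> oA Hu Hux Huy [x y] Az.
have [r r0 rA] := open_ball_sub oA Az.
pose c := y - r / 2.
have inA s t : x - r < s < x + r -> c <= t < y + r -> A (s, t).
  rewrite /c => sr /andP[ct tr]; apply: rA.
  by apply/ball_planeE => /=; split => //; apply/andP; split => //; lra.
have cr : c <= c < y + r by rewrite /c; lra.
have xr : x - r < x < x + r by lra.
have H t : c <= t < y + r ->
    (\int[mu]_(t in `[c, t]) uyx (x, t))%R = ux (x, t) - ux (x, c).
  move=> /[dup] ctr /andP[ct tr].
  have I1 : is_derive x (1 : R) (fun s => \int[mu]_(t in `[c, t]) uy (s, t))%R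
      (\int[mu]_(t in `[c, t]) uyx (x, t))%R.
    apply: (@derive_under_integral _ uy uyx (x - r) (x + r)) => //.
    move=> s t' sr /andP[tc ty].
    have tA : c <= t' < y + r by rewrite tc/=; lra.
    have [/cont_pairr ? d1 _ ? _] := Huy _ (inA _ _ sr tA).
    by split; [exact: d1| |].
  have I2 : is_derive x (1 : R) (fun s => u (s, t) - u (s, c))
      (ux (x, t) - ux (x, c)).
    have [/is_derive_xP D1 _] := Hu _ (inA _ _ xr ctr).
    have [/is_derive_xP D2 _] := Hu _ (inA _ _ xr cr).
    exact: is_deriveB.
  have /near_eq_is_derive /(_ I2) [_ <-] :
    \forall s \near x, u (s, t) - u (s, c) = (\int[mu]_(t in `[c, t]) uy (s, t))%R.
    near=> s.
    have sr : x - r < s < x + r.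
      by apply/andP; split; near: s; [apply: lt_nbhsr|apply: lt_nbhsl]; lra.
    apply/esym; apply: (@FTC2_cont _ (fun t => uy (s, t)) (fun t => u (s, t))) => //.
    - move=> t' /andP[tc ty].
      have tA : c <= t' < y + r by rewrite tc/=; lra.
      by apply/is_derive_yP; have [] := Hu _ (inA _ _ sr tA).
    - move=> t' /andP[tc ty].
      have tA : c <= t' < y + r by rewrite tc/=; lra.
      by have [/cont_pairr] := Huy _ (inA _ _ sr tA).
  by case: I1 => _ <-.
have cyr : c <= y < y + r by rewrite /c; lra.
have J1 : is_derive y (1 : R) (fun t => \int[mu]_(t in `[c, t]) uyx (x, t))%R
    (uyx (x, y)).
  apply: (@FTC1_right _ (fun t => uyx (x, t)) _ _ (y + r / 2)).
    by rewrite /c; lra.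
  move=> t /andP[ct tr].
  have tA : c <= t < y + r by rewrite ct/=; lra.
  by have [_ _ _ /cont_pairr] := Huy _ (inA _ _ xr tA).
have J2 : is_derive y (1 : R) (fun t => ux (x, t) - ux (x, c)) (uxy (x, y)).
  have [_ _ /is_derive_yP D1 _ _] := Hux _ (inA _ _ xr cyr).
  have := is_deriveB D1 (is_derive_cst (ux (x, c)) y 1).
  by rewrite subr0.
have /near_eq_is_derive /(_ J2) [_ <-] :
    \forall t \near y, ux (x, t) - ux (x, c) =
      (\int[mu]_(t in `[c, t]) uyx (x, t))%R.
  near=> t; rewrite H//; apply/andP; split; last first.
    by near: t; apply: lt_nbhsl; lra.
  by apply: ltW; near: t; apply: lt_nbhsr; rewrite /c; lra.
by case: J1.
Unshelve. all: by end_near. Qed.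

End LocalPotential.

(** * Increments of local potentials along chains *)

Section ConnectedDomains.
Context {R : realType}.
Implicit Types (A S : set (R * R)).

(** A property that is locally constant cuts [A] into two disjoint open pieces. *)
Lemma open_connected_ind A S z0 : open A -> connected A -> A z0 -> S z0 ->
  (forall z, A z -> \forall q \near z, S z <-> S q) ->
  forall z, A z -> S z.
Proof.
move=> oA cA Az0 Sz0 H z Az.
have inner (T : set (R * R)) :
    (forall z, A z -> T z -> \forall q \near z, T q) -> open (A `&` T).
  move=> HT; rewrite openE => y [Ay Ty]; apply: filterI; last exact: HT.
  exact: open_nbhs_nbhs.
have oS : open (A `&` S).
  by apply: inner => y /H Hy Sy; apply: filterS Hy => q [+ _]; exact.
have oC : open (A `&` ~` S).
  by apply: inner => y /H Hy Sy; apply: filterS Hy => q [_ qy] Sq; exact/Sy/qy.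
suff: A `&` S = A by move=> SA; have [] : (A `&` S) z by rewrite SA.
apply: cA.
- by exists z0.
- by exists (A `&` S) => //; rewrite setIA setIid.
- exists (~` (A `&` ~` S)); first exact: open_closedC.
  apply/seteqP; split=> y [Ay].
    by move=> Sy; split => // -[].
  by move=> Sy; split => //; apply: contrapT => nSy; apply: Sy.
Qed.

Lemma is_derive0_const (f : R -> R) (a b : R) :
  (forall t, Num.min a b <= t <= Num.max a b -> is_derive t (1 : R) f 0) ->
  f a = f b.
Proof.
wlog ab : a b / a <= b.
  move=> W H; have [ab|/ltW ba] := leP a b; first exact: W.
  by apply/esym; apply: W => // t; rewrite minC maxC; exact: H.
rewrite min_l// max_r// => H.
have d0 t : t \in `]a, b[ -> is_derive t (1 : R) f 0.
  by rewrite in_itv/= => /andP[ta tb]; apply: H; rewrite !ltW.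
have [] := MVT_segment ab d0.
  apply: within_cont => t; rewrite /= in_itv/= => tab.
  exact: is_derive_cont (H t tab).
by move=> c _; rewrite mul0r => /eqP; rewrite subr_eq0 => /eqP.
Qed.

(** Squares are products of intervals, so that [p] and [q] are joined inside both
    of them by a horizontal segment followed by a vertical one, along which the
    difference of the potentials has zero derivative. *)
Lemma potential_increment_unique (P Q u v : R * R -> R) z w (r s : R) p q :
  is_potential (ball z r) P Q u -> is_potential (ball w s) P Q v ->
  ball z r p -> ball z r q -> ball w s p -> ball w s q ->
  u q - u p = v q - v p.
Proof.
case: p q => [p1 p2] [q1 q2] Hu Hv.
move=> /ball_planeE/=[zp1 zp2] /ball_planeE/=[zq1 zq2].
move=> /ball_planeE/=[wp1 wp2] /ball_planeE/=[wq1 wq2].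
have between (a b c d t : R) : c < a < d -> c < b < d ->
    Num.min a b <= t <= Num.max a b -> c < t < d.
  move=> /andP[ca ad] /andP[cb bd]; rewrite ge_min le_max => /andP[].
  by move=> /orP[?|?] /orP[?|?]; apply/andP; split; lra.
pose f t := u (t, p2) - v (t, p2).
have fE : f p1 = f q1.
  apply: is_derive0_const => t tpq.
  have [/is_derive_xP du _] : is_derive (t, p2) ((1, 0) : R * R) u (P (t, p2)) /\
      is_derive (t, p2) ((0, 1) : R * R) u (Q (t, p2)).
    by apply: Hu; apply/ball_planeE; split => //=; exact: between tpq.
  have [/is_derive_xP dv _] : is_derive (t, p2) ((1, 0) : R * R) v (P (t, p2)) /\
      is_derive (t, p2) ((0, 1) : R * R) v (Q (t, p2)).
    by apply: Hv; apply/ball_planeE; split => //=; exact: between tpq.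
  by have := is_deriveB du dv; rewrite subrr.
pose g t := u (q1, t) - v (q1, t).
have gE : g p2 = g q2.
  apply: is_derive0_const => t tpq.
  have [_ /is_derive_yP du] : is_derive (q1, t) ((1, 0) : R * R) u (P (q1, t)) /\
      is_derive (q1, t) ((0, 1) : R * R) u (Q (q1, t)).
    by apply: Hu; apply/ball_planeE; split => //=; exact: between tpq.
  have [_ /is_derive_yP dv] : is_derive (q1, t) ((1, 0) : R * R) v (P (q1, t)) /\
      is_derive (q1, t) ((0, 1) : R * R) v (Q (q1, t)).
    by apply: Hv; apply/ball_planeE; split => //=; exact: between tpq.
  by have := is_deriveB du dv; rewrite subrr.
by move: fE gE; rewrite /f /g; lra.
Qed.

Lemma potential_unique A P Q u v : open A -> connected A -> A !=set0 ->
  is_potential A P Q u -> is_potential A P Q v ->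
  exists c : R, forall p, A p -> v p = u p + c.
Proof.
move=> oA cA [p0 Ap0] Hu Hv; exists (v p0 - u p0).
apply: (@open_connected_ind A _ p0) => //; first by rewrite addrC subrK.
move=> z Az; have [r r0 rA] := open_ball_sub oA Az.
near=> q.
have zq : ball z r q by near: q; exact: nbhsx_ballx.
have zz : ball z r z by exact: ballxx.
have Hur : is_potential (ball z r) P Q u by move=> p /rA; exact: Hu.
have Hvr : is_potential (ball z r) P Q v by move=> p /rA; exact: Hv.
have := potential_increment_unique Hur Hvr zz zq zz zq.
by split; lra.
Unshelve. all: by end_near. Qed.

End ConnectedDomains.

Section Monodromy.
Context {R : realType} (A : set (R * R)) (P Q : R * R -> R).

Definition chart (B : set (R * R)) (u : R * R -> R) : Prop :=
  [/\ exists z, exists r : R, B = ball z r, B `<=` A & is_potential B P Q u].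

Definition linked (p q : R * R) : Prop := exists B u, [/\ chart B u, B p & B q].

(** The increment of the closed form between two points of a common square; the
    value 0 is a default for points that are not linked. *)
Definition increment (p q : R * R) : R :=
  xget 0 [set d | exists B u, [/\ chart B u, B p, B q & d = u q - u p]].

Lemma incrementE B u p q : chart B u -> B p -> B q ->
  increment p q = u q - u p.
Proof.
move=> Bu Bp Bq; rewrite /increment.
case: xgetP => [d _ [B' [u' [B'u' B'p B'q ->]]]|/(_ (u q - u p))]; last first.
  by case; exists B, u.
case: Bu B'u' Bp Bq B'p B'q => -[z [r ->]] _ Hu [[z' [r' ->]] _ Hu'] Bp Bq B'p B'q.
exact: (@potential_increment_unique _ P Q u' u z' z r' r).
Qed.

Lemma increment_rev p q : linked p q -> increment q p = - increment p q.
Proof. by case=> B [u [Bu Bp Bq]]; rewrite !(incrementE Bu)// opprB. Qed.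

Lemma linked_sym p q : linked p q -> linked q p.
Proof. by case=> B [u [Bu Bp Bq]]; exists B, u. Qed.

(** The discrete substitute for a path together with the line integral of
    [P dx + Q dy] along it. *)
Inductive chain : R * R -> R * R -> R -> Prop :=
| chain0 p : A p -> chain p p 0
| chainS p q r v : linked p q -> chain q r v -> chain p r (increment p q + v).

Lemma chain_trans p q r v w : chain p q v -> chain q r w -> chain p r (v + w).
Proof.
elim=> {p q v} [p _|p q s v pq _ IH] H; first by rewrite add0r.
by rewrite -addrA; apply: chainS => //; exact: IH.
Qed.

Lemma linked_in p q : linked p q -> A p /\ A q.
Proof. by case=> B [u [[_ BA _] Bp Bq]]; split; exact: BA. Qed.

Lemma chain1 p q : linked p q -> chain p q (increment p q).
Proof.
move=> pq; rewrite -[increment p q]addr0; apply: chainS => //.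
by apply: chain0; case: (linked_in pq).
Qed.

Lemma chain_sym p q v : chain p q v -> chain q p (- v).
Proof.
elim=> {p q v} [p Ap|p q s v pq _ IH]; first by rewrite oppr0; exact: chain0.
rewrite opprD addrC -increment_rev//; apply: chain_trans IH _.
exact/chain1/linked_sym.
Qed.

Lemma chain_nat p q v : chain p q v -> exists m (a : nat -> R * R),
  [/\ a 0%N = p, a m = q, A p, forall i, (i < m)%N -> linked (a i) (a i.+1) &
      v = \sum_(i < m) increment (a i) (a i.+1)].
Proof.
elim=> {p q v} [p Ap|p q s v pq _ [m [a [a0 am _ al ->]]]].
  by exists 0%N, (fun=> p); split => //; rewrite big_ord0.
exists m.+1, (fun i => if i is i'.+1 then a i' else p); split => //.
- by case: (linked_in pq).
- by case=> [|i]; [rewrite a0|rewrite ltnS; exact: al].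
- by rewrite big_ord_recl/= a0.
Qed.

(** The two sequences are the sides of a ladder, each cell of which lies in one
    chart. Increments around a cell cancel, as differences of values of one
    potential, so that the two sums differ by the increments along the end
    rungs, and these rungs are single points. *)
Lemma sum_increment_homotopic N a b :
  (forall j, (j < N)%N -> exists B u,
     [/\ chart B u, B (a j), B (a j.+1), B (b j) & B (b j.+1)]) ->
  a 0%N = b 0%N -> a N = b N ->
  \sum_(j < N) increment (a j) (a j.+1) = \sum_(j < N) increment (b j) (b j.+1).
Proof.
move=> H ab0 abN.
(* Partial sums differ by the increment along the rung from [a k] to [b k].
   The rung at 0 is a single point and counts as 0 without reference to a
   chart. *)
suff S k : (k <= N)%N -> \sum_(j < k) increment (a j) (a j.+1) +
    (if k == 0%N then 0 else increment (a k) (b k)) =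
    \sum_(j < k) increment (b j) (b j.+1).
  have := S N (leqnn N); case: (N =P 0%N) => [-> _|/eqP N0].
    by rewrite !big_ord0.
  case: N N0 abN H {S} => // N _ abN H <-.
  have [B [u [Bu _ Ba _ _]]] := H N (ltnSn N).
  by rewrite -abN (incrementE Bu)// subrr addr0.
elim: k => [_|k IH kN]; first by rewrite !big_ord0 addr0.
rewrite !big_ord_recr/= -IH; last exact: ltnW.
have [B [u [Bu Ba Ba1 Bb Bb1]]] := H k kN.
rewrite !(incrementE Bu)//.
case: (k =P 0%N) => [k0|_]; last by ring.
by rewrite k0 ab0 in Ba *; ring.
Qed.

(** By compactness, a fine grid on the parameter square has all its cells mapped
    into charts. Consecutive rows of the grid then have equal sums, and the last
    row is constant. *)
Lemma null_homotopic_sum (c : R -> R * R) :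
  (forall z, A z -> exists B u, [/\ chart B u, B z & open B]) ->
  null_homotopic_in A c ->
  \forall N \near \oo,
    \sum_(j < N.+1) increment (c (j%:R / N.+1%:R)) (c (j.+1%:R / N.+1%:R)) = 0.
Proof.
move=> loc [h [hc hA h0 h1 hs]].
pose K := (`[0, 1] `*` `[0, 1] : set (R * R)).
have cK : compact K by apply: compact_setX; exact: segment_compact.
pose G (N : nat) (z : R * R) := exists B u, chart B u /\
  forall s t : R, K (s, t) -> `|z.1 - s| <= N.+1%:R^-1 ->
    `|z.2 - t| <= N.+1%:R^-1 -> B (h (s, t)).
(* This is the Lebesgue number argument, with mesh [1 / N.+1]. *)
have [N0 _ HN] : \forall N \near \oo, K `<=` G N.
  apply: (compact_near_coveringP K).1 => // z Kz.
  have Ahz : A (h z).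
    by case: z Kz => s t [/=]; rewrite !in_itv/= => ? ?; exact: hA.
  have [B [u [Bu Bhz oB]]] := loc _ Ahz.
  have : within K (nbhs z) (h @^-1` B).
    have /subspace_continuousP/(_ z Kz) := hc.
    by apply; exact: open_nbhs_nbhs.
  move=> /nbhs_ballP[e /= e0 eB].
  have e2 : 0 < e / 2 by rewrite divr_gt0.
  near=> z' N; exists B, u; split => // s t Kst zs zt.
  have zz' : ball z (e / 2) z'.
    by near: z'; exact: nbhsx_ballx.
  apply: eB => //; rewrite (splitr e); apply: (ball_triangle zz').
  have Ne : N.+1%:R^-1 < e / 2.
    by near: N; exact: (near_infty_natSinv_lt (PosNum e2)).
  by split; rewrite /ball/=; exact: le_lt_trans Ne.
exists N0 => // N /= /HN {}HN.
pose x (i : nat) : R := i%:R / N.+1%:R.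
have N1 : (N.+1%:R : R) != 0 by rewrite pnatr_eq0.
have x0 : x 0%N = 0 by rewrite /x mul0r.
have xN : x N.+1 = 1 by rewrite /x divff.
have x01 i : (i <= N.+1)%N -> 0 <= x i <= 1.
  by move=> iN; rewrite /x divr_ge0//= ler_pdivrMr ?ltr0n// mul1r ler_nat.
have xS i : `|x i - x i.+1| <= N.+1%:R^-1.
  rewrite /x -mulrBl normrM [X in _ * X]ger0_norm ?invr_ge0 ?ler0n//.
  by rewrite -natr1 opprD addrA subrr add0r normrN normr1 mul1r.
have xx i : `|x i - x i| <= N.+1%:R^-1 by rewrite subrr normr0 invr_ge0 ler0n.
have Kx i j : (i <= N.+1)%N -> (j <= N.+1)%N -> K (x i, x j).
  by move=> iN jN; split; rewrite /= in_itv/=; exact: x01.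
pose row i := \sum_(j < N.+1) increment (h (x i, x j)) (h (x i, x j.+1)).
have rowS i : (i < N.+1)%N -> row i = row i.+1.
  move=> iN; apply: (@sum_increment_homotopic N.+1 (fun j => h (x i, x j))
    (fun j => h (x i.+1, x j))) => [j jN||].
  - have [B [u [Bu BH]]] := HN _ (Kx _ _ (ltnW iN) (ltnW jN)).
    have [iN' jN'] := (ltnW iN, ltnW jN).
    by exists B, u; split => //; (apply: BH; [exact: Kx|first [exact: xx|exact: xS]..]).
  - rewrite x0; have [-> _] := hs _ (x01 _ (ltnW iN)).
    by have [-> _] := hs _ (x01 _ iN).
  - rewrite xN; have [_ ->] := hs _ (x01 _ (ltnW iN)).
    by have [_ ->] := hs _ (x01 _ iN).
have row0 : row 0%N = row N.+1.
  suff S k : (k <= N.+1)%N -> row 0%N = row k by exact: S.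
  by elim: k => // k IH kN; rewrite -rowS// IH// ltnW.
transitivity (row 0%N).
  apply: eq_bigr => j _; rewrite x0 -!/(x _) !h0//; apply: x01 => //.
  exact: ltnW.
rewrite row0 /row big1// => j _; rewrite xN !h1; last 2 first.
- by apply: x01.
- by apply: x01; exact: ltnW.
have Ac0 : A (c 0) by rewrite -h0 ?lexx ?ler01//; apply: hA; rewrite ?lexx ?ler01.
have [B [u [Bu Bc _]]] := loc _ Ac0.
by rewrite (incrementE Bu Bc Bc) subrr.
Unshelve. all: by end_near. Qed.

End Monodromy.

(** * Global potentials on simply connected domains *)

Section Polylines.
Context {R : realType}.
Implicit Types (a : nat -> R * R) (s t : R).

Definition clamp s : R := Num.min 1 (Num.max 0 s).

Lemma clamp_id s : 0 <= s <= 1 -> clamp s = s.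
Proof. by move=> /andP[s0 s1]; rewrite /clamp max_r// min_r. Qed.

Lemma clamp0 s : s <= 0 -> clamp s = 0.
Proof. by move=> s0; rewrite /clamp max_l// min_r. Qed.

Lemma clamp1 s : 1 <= s -> clamp s = 1.
Proof. by move=> s1; rewrite /clamp max_r ?min_l// (le_trans _ s1). Qed.

Lemma clamp_continuous : continuous clamp.
Proof.
move=> s; apply: (@continuous_min _ _ (fun=> 1) (fun s : R => Num.max 0 s)).
  exact: cst_continuous.
apply: (@continuous_max _ _ (fun=> 0) (fun s : R => s)).
  exact: cst_continuous.
exact: cvg_id.
Qed.

(** The polygonal path through [a 0], [a 1], ..., with [a i] reached at time [i].
    Writing it as a sum of clamped segments makes its continuity immediate. *)
Fixpoint polyline a (m : nat) s : R * R :=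
  if m is m'.+1 then
    polyline a m' s + clamp (s - m'%:R) *: (a m'.+1 - a m')
  else a 0%N.

Lemma polyline_continuous a m : continuous (polyline a m).
Proof.
elim: m => [|m IH] s; first exact: cst_continuous.
apply: (@continuousD _ _ _ (polyline a m)
  (fun s => clamp (s - m%:R) *: (a m.+1 - a m))); first exact: IH.
apply: (@continuous_comp _ _ _ (fun s => clamp (s - m%:R))
  (fun k : R => k *: (a m.+1 - a m))); last exact: scalel_continuous.
apply: (@continuous_comp _ _ _ (fun s => s - m%:R) clamp).
  by apply: continuousB; [exact: cvg_id|exact: cst_continuous].
exact: clamp_continuous.
Qed.

Lemma polyline_end a m s : m%:R <= s -> polyline a m s = a m.
Proof.
elim: m => //= m IH ms.
rewrite IH; last by apply: le_trans ms; rewrite ler_nat.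
rewrite clamp1; first by rewrite scale1r addrC subrK.
by rewrite -natr1 in ms; lra.
Qed.

Lemma polylineE a m k t : (k < m)%N -> 0 <= t <= 1 ->
  polyline a m (k%:R + t) = a k + t *: (a k.+1 - a k).
Proof.
move=> + t01; elim: m => // m IH; rewrite ltnS leq_eqVlt => /predU1P[->|km] /=.
  rewrite polyline_end; last by rewrite lerDl; case/andP: t01.
  by rewrite (addrC m%:R) addrK clamp_id.
rewrite IH// clamp0 ?scale0r ?addr0//.
have : k.+1%:R <= m%:R :> R by rewrite ler_nat.
by case/andP: t01 => _; rewrite -natr1; lra.
Qed.

Lemma polyline_locate m s : (0 < m)%N -> 0 <= s <= m%:R ->
  exists k t, [/\ (k < m)%N, 0 <= t <= 1 & s = k%:R + t].
Proof.
move=> + /andP[s0]; elim: m => // m IH _ sm.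
have [ms|sm'] := leP m%:R s.
  exists m, (s - m%:R); split => //; last by rewrite addrC subrK.
  by rewrite -natr1 in sm; apply/andP; split; lra.
case: m IH sm sm' => [|m] IH sm sm'; first by move: (le_lt_trans s0 sm'); rewrite ltxx.
have [k [t [km t01 ->]]] := IH isT (ltW sm').
by exists k, t; split => //; exact: ltnW.
Qed.

Lemma segment_itv (a b p q t : R) : a < p < b -> a < q < b -> 0 <= t <= 1 ->
  a < p + t * (q - p) < b.
Proof.
move=> /andP[ap pb] /andP[aq qb] /andP[t0 t1].
have convex (x y : R) : 0 < x -> 0 < y -> 0 < (1 - t) * x + t * y.
  move=> x0 y0; have [->|tN0] := eqVneq t 0; first by rewrite subr0 mul0r; lra.
  apply: ltr_wpDl; first by apply: mulr_ge0; lra.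
  by apply: mulr_gt0 => //; rewrite lt0r tN0.
have : 0 < (1 - t) * (p - a) + t * (q - a) by apply: convex; rewrite subr_gt0.
have : 0 < (1 - t) * (b - p) + t * (b - q) by apply: convex; rewrite subr_gt0.
by move=> ? ?; apply/andP; split; lra.
Qed.

Lemma ball_segment z (r : R) (p q : R * R) t : ball z r p -> ball z r q ->
  0 <= t <= 1 -> ball z r (p + t *: (q - p)).
Proof.
move=> /ball_planeE[p1 p2] /ball_planeE[q1 q2] t01; apply/ball_planeE.
by split; exact: segment_itv.
Qed.

End Polylines.

Section GlobalPotential.
Context {R : realType} (A : set (R * R)) (P Q : R * R -> R).
Hypothesis scA : simply_connected_domain A.
Hypothesis loc : forall z, A z -> exists r : R, [/\ 0 < r, ball z r `<=` A &
    exists u, is_potential (ball z r) P Q u].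

Notation increment := (increment A P Q).
Notation linked := (linked A P Q).
Notation chart := (chart A P Q).
Notation chain := (chain A P Q).

Lemma chart_at z : A z -> exists B u, [/\ chart B u, B z & open B].
Proof.
move=> /loc[r [r0 rA [u Hu]]]; exists (ball z r), u; split.
- by split => //; exists z, r.
- exact: ballxx.
- exact: ball_open.
Qed.

(** Subdividing an edge inside a chart does not change its increment, since the
    sum telescopes. *)
Lemma sum_increment_segment B u p q M : chart B u -> B p -> B q ->
  \sum_(j < M.+1) increment (p + (j%:R / M.+1%:R) *: (q - p))
                          (p + (j.+1%:R / M.+1%:R) *: (q - p)) = increment p q.
Proof.
move=> Bu Bp Bq.
pose x (i : nat) : R * R := p + (i%:R / M.+1%:R) *: (q - p).
have Bx i : (i <= M.+1)%N -> B (x i).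
  case: Bu Bp Bq => -[z [r ->]] _ _ Bp Bq iM; apply: ball_segment => //.
  by rewrite divr_ge0//= ler_pdivrMr ?ltr0n// mul1r ler_nat.
transitivity (\sum_(0 <= j < M.+1) (u (x j.+1) - u (x j))).
  rewrite big_mkord; apply: eq_bigr => j _; rewrite -!/(x _).
  by rewrite (incrementE Bu)//; apply: Bx => //; exact: ltnW.
rewrite telescope_sumr// /x mul0r scale0r addr0 divff ?pnatr_eq0// scale1r.
by rewrite (addrC p) subrK (incrementE Bu).
Qed.

(** The closed polygon through the points of the chain is a loop, hence
    null-homotopic, and the subdivided sums along it reduce to the sum along the
    chain. *)
Lemma closed_chain_sum m (a : nat -> R * R) :
  A (a 0%N) -> a 0%N = a m -> (forall i, (i < m)%N -> linked (a i) (a i.+1)) ->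
  \sum_(i < m) increment (a i) (a i.+1) = 0.
Proof.
case: m => [|m] Aa0 a0m al; first by rewrite big_ord0.
have [_ _ _ /(_ (fun t => polyline a m.+1 (m.+1%:R * t)))] := scA.
case.
- apply: continuous_subspaceT => t.
  apply: (@continuous_comp _ _ _ (fun t : R => m.+1%:R * t) (polyline a m.+1)).
    by apply: continuousM; [exact: cst_continuous|exact: cvg_id].
  exact: polyline_continuous.
- move=> t /andP[t0 t1].
  have [k [s [km s01 ->]]] : exists k s, [/\ (k < m.+1)%N, 0 <= s <= 1 &
      m.+1%:R * t = k%:R + s].
    by apply: polyline_locate => //; rewrite mulr_ge0//= ger_pMr ?ltr0n.
  rewrite polylineE//; have [B [u [[[z [r ->]] BA _] Bk Bk1]]] := al _ km.
  by apply: BA; exact: ball_segment.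
- rewrite mulr0 mulr1 [RHS]polyline_end// -a0m.
  have := @polylineE _ a m.+1 0%N 0 isT.
  by rewrite add0r lexx ler01 scale0r addr0 => ->.
(* The number of subdivisions is a multiple of the number of edges, so that
   the vertices of the polygon are among the subdivision points. *)
move=> h hH; have [N0 _] := null_homotopic_sum chart_at (ex_intro _ h hH).
move=> /(_ (m.+1 * N0.+1).-1); rewrite prednK ?muln_gt0//.
have N0le : (N0 <= (m.+1 * N0.+1).-1)%N by rewrite -ltnS prednK ?muln_gt0// mulSn leq_addr.
move=> /(_ N0le) S0; rewrite -[RHS]S0 {S0}.
have n0 : ((m.+1 * N0.+1)%:R : R) != 0 by rewrite pnatr_eq0 muln_eq0.
pose F l := increment
  (polyline a m.+1 (m.+1%:R * (l%:R / (m.+1 * N0.+1)%:R)))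
  (polyline a m.+1 (m.+1%:R * (l.+1%:R / (m.+1 * N0.+1)%:R))).
have FE k j : (k < m.+1)%N -> (j < N0.+1)%N -> F (k * N0.+1 + j)%N =
    increment (a k + (j%:R / N0.+1%:R) *: (a k.+1 - a k))
              (a k + (j.+1%:R / N0.+1%:R) *: (a k.+1 - a k)).
  move=> km jN; have pE i : (i <= N0.+1)%N ->
      polyline a m.+1 (m.+1%:R * ((k * N0.+1 + i)%:R / (m.+1 * N0.+1)%:R)) =
      a k + (i%:R / N0.+1%:R) *: (a k.+1 - a k).
    move=> iN; rewrite -(@polylineE _ a m.+1 k)//.
      congr polyline; rewrite natrM natrD natrM in n0 *; field.
      by rewrite ![1 + _]addrC !natr1 !pnatr_eq0.
    by rewrite divr_ge0//= ler_pdivrMr ?ltr0n// mul1r ler_nat.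
  by rewrite /F -addnS !pE// ltnW.
have SE k : (k <= m.+1)%N -> \sum_(l < k * N0.+1) F l =
    \sum_(i < k) increment (a i) (a i.+1).
  elim: k => [|k IH] km; first by rewrite mul0n !big_ord0.
  rewrite mulSn addnC big_split_ord/= IH ?(ltnW km)// [RHS]big_ord_recr/=.
  congr (_ + _).
  have [B [u [Bu Bk Bk1]]] := al _ km.
  rewrite -(sum_increment_segment N0 Bu Bk Bk1).
  by apply: eq_bigr => j _; rewrite FE.
by rewrite -SE.
Qed.

Lemma chain_value_unique p q v w : chain p q v -> chain p q w -> v = w.
Proof.
move=> /chain_trans H /chain_sym/H/chain_nat[m [a [a0 am Ap al]]].
rewrite closed_chain_sum ?a0 ?am// => /eqP.
by rewrite subr_eq0 => /eqP.
Qed.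

Lemma global_potential : exists u, is_potential A P Q u.
Proof.
have [oA [p0 Ap0] cA _] := scA.
have chain_to q : A q -> exists v, chain p0 q v.
  move: q; apply: (@open_connected_ind _ A _ p0) => //.
    by exists 0; exact: chain0.
  move=> z /chart_at[B [u [Bu Bz oB]]]; near=> q.
  have Bq : B q by near: q; exact: open_near.
  by split=> -[v /chain_trans H]; eexists; apply: H; apply: chain1; exists B, u.
pose g q := xget 0 [set v | chain p0 q v].
have gP q : A q -> chain p0 q (g q).
  move=> /chain_to[v Hv]; rewrite /g.
  by case: xgetP => [w _ //|/(_ v)]; case.
exists g => z Az.
have [B [u [Bu Bz oB]]] := chart_at Az.
have ug q : B q -> u q + (g z - u z) = g q.
  move=> Bq; have zq : linked z q by exists B, u.
  have Aq : A q by case: (linked_in zq).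
  have := chain_value_unique (chain_trans (gP _ Az) (chain1 zq)) (gP _ Aq).
  by rewrite (incrementE Bu)// => <-; ring.
have near_ug : \forall q \near z, u q + (g z - u z) = g q.
  by near=> q; apply: ug; near: q; exact: open_near.
have [_ _ /(_ _ Bz)[ux uy]] := Bu.
split; apply: (near_eq_is_derive near_ug).
- have := is_deriveD ux (is_derive_cst (g z - u z) z ((1, 0) : R * R)).
  by rewrite addr0.
- have := is_deriveD uy (is_derive_cst (g z - u z) z ((0, 1) : R * R)).
  by rewrite addr0.
Unshelve. all: by end_near. Qed.

End GlobalPotential.

(** * Matrix-valued maps and coordinates *)

Section MatrixValuedMaps.
Context {R : realType} {m n : nat}.
Implicit Types (M : R * R -> 'M[R]_(m, n)) (A : set (R * R)).

(** Matrices carry the product topology. *)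
Lemma mx_cont M p :
  {for p, continuous M} <-> forall i j, {for p, continuous (fun q => M q i j)}.
Proof.
split=> [Mc i j|Mc U [W MW WU]].
  by apply: (@continuous_comp _ _ _ M (fun N : 'M[R]_(m, n) => N i j)) => //;
    exact: coord_continuous.
have Wi i : nbhs p (fun q => forall j, W i j (M q i j)).
  exact: (@filter_forall _ _ (fun j q => W i j (M q i j)) (nbhs p) _
    (fun j => Mc i j _ (MW i j))).
by apply: filterS (@filter_forall _ _ _ (nbhs p) _ Wi) => q; exact: WU.
Qed.

Lemma derive_entry M p d i j : derivable M p d ->
  ('D_d M p) i j = 'D_d (fun q => M q i j) p.
Proof. by move=> dM; rewrite derive_mx// mxE. Qed.

Lemma C1_on_eq A (u v : R * R -> R) : open A -> (forall p, A p -> u p = v p) ->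
  C1_on A u -> C1_on A v.
Proof.
move=> oA uv uC p Ap; have [d1 d2 c1 c2] := uC p Ap.
have nuv q : A q -> \forall q' \near q, u q' = v q'.
  by move=> Aq; near=> q'; apply: uv; near: q'; exact: open_near.
split.
- exact: near_eq_derivable (nuv _ Ap) d1.
- exact: near_eq_derivable (nuv _ Ap) d2.
- apply: near_eq_cont c1; near=> q; apply: near_eq_derive; apply: nuv.
  by near: q; exact: open_near.
- apply: near_eq_cont c2; near=> q; apply: near_eq_derive; apply: nuv.
  by near: q; exact: open_near.
Unshelve. all: by end_near. Qed.

Lemma C1_on_entries A M : open A ->
  C1_on A M <-> forall i j, C1_on A (fun p => M p i j).
Proof.
move=> oA; split=> [MC i j p Ap|MC p Ap].
- have [/derivable_mxP d1 /derivable_mxP d2 /mx_cont c1 /mx_cont c2] := MC p Ap.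
  split; [exact: d1|exact: d2| |].
  + apply: near_eq_cont (c1 i j); near=> q; apply: derive_entry.
    have Aq : A q by near: q; exact: open_near.
    by have [dq _ _ _] := MC q Aq; exact: dq.
  + apply: near_eq_cont (c2 i j); near=> q; apply: derive_entry.
    have Aq : A q by near: q; exact: open_near.
    by have [_ dq _ _] := MC q Aq; exact: dq.
- have dM q : A q -> derivable M q ((1, 0) : R * R) /\
      derivable M q ((0, 1) : R * R).
    move=> Aq; split; apply/derivable_mxP => i j.
      by have [dij _ _ _] := MC i j q Aq; exact: dij.
    by have [_ dij _ _] := MC i j q Aq; exact: dij.
  have [d1 d2] := dM _ Ap.
  split; [exact: d1|exact: d2| |]; apply/mx_cont => i j;
    have [_ _ c1 c2] := MC i j p Ap.
  + apply: near_eq_cont c1; near=> q; apply/esym/derive_entry.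
    have /dM[dq _] : A q by near: q; exact: open_near.
    exact: dq.
  + apply: near_eq_cont c2; near=> q; apply/esym/derive_entry.
    have /dM[_ dq] : A q by near: q; exact: open_near.
    exact: dq.
Unshelve. all: by end_near. Qed.

Lemma dx_entry A M i j p : C1_on A M -> A p ->
  dx M p i j = dx (fun q => M q i j) p.
Proof.
move=> MC Ap; have [dp _ _ _] := MC p Ap; apply: derive_entry; exact: dp.
Qed.

Lemma dy_entry A M i j p : C1_on A M -> A p ->
  dy M p i j = dy (fun q => M q i j) p.
Proof.
move=> MC Ap; have [_ dp _ _] := MC p Ap; apply: derive_entry; exact: dp.
Qed.

Lemma C2_on_entries A M : open A ->
  C2_on A M <-> forall i j, C2_on A (fun p => M p i j).
Proof.
move=> oA; split=> [[M1 Mx My] i j|H].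
- have M1' := (C1_on_entries M oA).1 M1.
  have Mx' := (C1_on_entries (dx M) oA).1 Mx i j.
  have My' := (C1_on_entries (dy M) oA).1 My i j.
  split; first exact: M1'.
    by apply: (C1_on_eq oA _ Mx') => p; exact: dx_entry.
  by apply: (C1_on_eq oA _ My') => p; exact: dy_entry.
- have M1 : C1_on A M.
    by apply/(C1_on_entries M oA) => i j; have [H1 _ _] := H i j; exact: H1.
  split; first exact: M1.
    apply/(C1_on_entries (dx M) oA) => i j; have [_ Hx _] := H i j.
    apply: (C1_on_eq oA _ Hx) => p Ap; apply/esym; exact: dx_entry M1 Ap.
  apply/(C1_on_entries (dy M) oA) => i j; have [_ _ Hy] := H i j.
  apply: (C1_on_eq oA _ Hy) => p Ap; apply/esym; exact: dy_entry M1 Ap.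
Qed.

Lemma second_partials_entry A M i j p : open A -> C2_on A M -> A p ->
  [/\ dx (dx M) p i j = dx (dx (fun q => M q i j)) p,
      dx (dy M) p i j = dx (dy (fun q => M q i j)) p &
      dy (dy M) p i j = dy (dy (fun q => M q i j)) p].
Proof.
move=> oA [M1 Mx My] Ap; split.
- rewrite (dx_entry _ _ Mx)//; apply: near_eq_derive; near=> q.
  by apply: dx_entry M1 _; near: q; exact: open_near.
- rewrite (dx_entry _ _ My)//; apply: near_eq_derive; near=> q.
  by apply: dy_entry M1 _; near: q; exact: open_near.
- rewrite (dy_entry _ _ My)//; apply: near_eq_derive; near=> q.
  by apply: dy_entry M1 _; near: q; exact: open_near.
Unshelve. all: by end_near. Qed.

End MatrixValuedMaps.

Section CoordinateFunctions.
Context {R : realType}.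
Implicit Types (A : set (R * R)).

Lemma derive_coordinates (p : R * R) :
  [/\ is_derive p ((1, 0) : R * R) (fun q : R * R => q.1) 1,
      is_derive p ((0, 1) : R * R) (fun q : R * R => q.1) 0,
      is_derive p ((1, 0) : R * R) (fun q : R * R => q.2) 0 &
      is_derive p ((0, 1) : R * R) (fun q : R * R => q.2) 1].
Proof.
case: p => x y; split.
- by apply/is_derive_xP; exact: is_derive_id.
- by apply/is_derive_yP; exact: is_derive_cst.
- by apply/is_derive_xP; exact: is_derive_cst.
- by apply/is_derive_yP; exact: is_derive_id.
Qed.

Lemma dx_fst : dx (fun q : R * R => q.1) = fun=> 1.
Proof. by apply/funext => p; have [[_ e] _ _ _] := derive_coordinates p. Qed.
Lemma dy_fst : dy (fun q : R * R => q.1) = fun=> 0.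
Proof. by apply/funext => p; have [_ [_ e] _ _] := derive_coordinates p. Qed.
Lemma dx_snd : dx (fun q : R * R => q.2) = fun=> 0.
Proof. by apply/funext => p; have [_ _ [_ e] _] := derive_coordinates p. Qed.
Lemma dy_snd : dy (fun q : R * R => q.2) = fun=> 1.
Proof. by apply/funext => p; have [_ _ _ [_ e]] := derive_coordinates p. Qed.

Lemma dx_cst (k : R) : dx (fun=> k) = fun=> 0.
Proof. by apply/funext => p; exact: derive_cst. Qed.
Lemma dy_cst (k : R) : dy (fun=> k) = fun=> 0.
Proof. by apply/funext => p; exact: derive_cst. Qed.

Lemma C1_on_cst A (k : R) : C1_on A (fun=> k).
Proof.
move=> p _; rewrite dx_cst dy_cst.
split; [exact: derivable_cst|exact: derivable_cst| |]; exact: cst_continuous.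
Qed.

Lemma C2_on_fst A : C2_on A (fun q : R * R => q.1).
Proof.
split; rewrite ?dx_fst ?dy_fst; [|exact: C1_on_cst..] => p _.
have [[d1 _] [d2 _] _ _] := derive_coordinates p; rewrite dx_fst dy_fst.
split; [exact: d1|exact: d2| |]; exact: cst_continuous.
Qed.

Lemma C2_on_snd A : C2_on A (fun q : R * R => q.2).
Proof.
split; rewrite ?dx_snd ?dy_snd; [|exact: C1_on_cst..] => p _.
have [_ _ [d1 _] [d2 _]] := derive_coordinates p; rewrite dx_snd dy_snd.
split; [exact: d1|exact: d2| |]; exact: cst_continuous.
Qed.

End CoordinateFunctions.

(** * First fundamental form and mean curvature of a graph *)

Section Sums.
Context {R : realFieldType} {n : nat}.
Implicit Types (x y : 'I_n -> R).

Lemma sum_bilinear x y (a b c d : R) :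
  \sum_k (a * x k + b * y k) * (c * x k + d * y k) =
  a * c * \sum_k x k * x k + (a * d + b * c) * \sum_k x k * y k
    + b * d * \sum_k y k * y k.
Proof. by rewrite !mulr_sumr -!big_split/=; apply: eq_bigr => k _; ring. Qed.

(** The summand is symmetric in [i] and [j] and vanishes on the diagonal, so the
    sum over [i < j] is half of the full double sum, which factors. *)
Lemma Lagrange_identity x y :
  \sum_(i < n) \sum_(j < n | (i < j)%N) (x i * y j - y i * x j) ^+ 2 =
  (\sum_k x k * x k) * (\sum_k y k * y k) - (\sum_k x k * y k) ^+ 2.
Proof.
pose F i j := (x i * y j - y i * x j) ^+ 2.
pose S := \sum_(i < n) \sum_(j < n | (i < j)%N) F i j.
have full : \sum_i \sum_j F i j = S + S.
  have S2 : S = \sum_(i < n) \sum_(j < n | (j < i)%N) F j i.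
    by rewrite /S (exchange_big_dep xpredT).
  rewrite {2}S2 /S -big_split/=; apply: eq_bigr => i _.
  rewrite [LHS](bigID (fun j : 'I_n => (i < j)%N))/=; congr (_ + _).
  rewrite [LHS](bigID (fun j : 'I_n => (j < i)%N))/= [X in _ + X]big1 ?addr0.
    apply: eq_big => [j|j _]; last by rewrite /F; ring.
    by rewrite -leqNgt andb_idl// => /ltnW.
  move=> j; rewrite -!leqNgt -eqn_leq => /eqP/val_inj ->.
  by rewrite /F; ring.
have : \sum_i \sum_j F i j = 2 * ((\sum_k x k * x k) * (\sum_k y k * y k)
    - (\sum_k x k * y k) ^+ 2).
  rewrite expr2 mulrBr !big_distrlr/= !mulr_sumr -sumrB.
  transitivity (\sum_i \sum_j (x i * x i * (y j * y j) + y i * y i * (x j * x j)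
      - 2 * (x i * y i * (x j * y j)))).
    by apply: eq_bigr => i _; apply: eq_bigr => j _; rewrite /F; ring.
  rewrite (eq_bigr (fun i => \sum_j x i * x i * (y j * y j) +
      \sum_j y i * y i * (x j * x j) - 2 * \sum_j (x i * y i * (x j * y j)))).
    rewrite !sumrB big_split/= -[in RHS]mulr_sumr; congr (_ - _).
    rewrite [X in _ + X]exchange_big/= -big_split/= mulr2n mulrDl !mul1r.
    rewrite -big_split/=; apply: eq_bigr => i _; congr (_ + _).
    by apply: eq_bigr => j _; rewrite mulrC.
  by move=> i _; rewrite mulr_sumr -big_split/= -sumrB.
by rewrite full /S; lra.
Qed.

End Sums.

Section NormalPart.
Context {R : realType} {m : nat} (s : 'I_m -> R).

Lemma mdot_combination (u v x y : 'rV[R]_m) (a b c : R) :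
  mdot s (a *: u - b *: v + c *: x) y =
  a * mdot s u y - b * mdot s v y + c * mdot s x y.
Proof.
rewrite /mdot !mulr_sumr -sumrB -big_split/=; apply: eq_bigr => i _.
by rewrite !mxE; ring.
Qed.

(** The normal part of a vector, with the tangent vectors and the coefficients of
    the Gram matrix as free parameters: its linearity is then a formal identity. *)
Definition gram_projection (E F G W : R) (d1 d2 w : 'rV[R]_m) : 'rV[R]_m :=
  w - ((G * mdot s w d1 - F * mdot s w d2) / W) *: d1
    - ((E * mdot s w d2 - F * mdot s w d1) / W) *: d2.

Lemma gram_projection_combination E F G W d1 d2 (u v x : 'rV[R]_m) (a b c : R) :
  W != 0 ->
  a *: gram_projection E F G W d1 d2 u - b *: gram_projection E F G W d1 d2 v
    + c *: gram_projection E F G W d1 d2 x =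
  gram_projection E F G W d1 d2 (a *: u - b *: v + c *: x).
Proof.
move=> W0; rewrite /gram_projection !mdot_combination.
by apply/rowP => i; rewrite !mxE; field.
Qed.

Lemma gram_projection0 E F G W d1 d2 : gram_projection E F G W d1 d2 0 = 0.
Proof.
have m0 (y : 'rV[R]_m) : mdot s 0 y = 0.
  by apply: big1 => i _; rewrite mxE mulr0 mul0r.
by rewrite /gram_projection !m0 !mulr0 !subr0 !mul0r !scale0r !subr0.
Qed.

Variables (X : R * R -> 'rV[R]_m) (p : R * R).

Lemma normal_part_projection (w : 'rV[R]_m) : normal_part s X p w =
  gram_projection (ffE s X p) (ffF s X p) (ffG s X p) (gram s X p)
    (dx X p) (dy X p) w.
Proof. reflexivity. Qed.

Lemma mean_curvature_vectorE (xx xy yy : 'rV[R]_m) : gram s X p != 0 ->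
  dx (dx X) p = xx -> dx (dy X) p = xy -> dy (dy X) p = yy ->
  mean_curvature_vector s X p = (2 * gram s X p)^-1 *: normal_part s X p
    (ffG s X p *: xx - (2 * ffF s X p) *: xy + ffE s X p *: yy).
Proof.
move=> W0 <- <- <-; rewrite /mean_curvature_vector.
congr (_ *: _); exact: (gram_projection_combination _ _ _ _ _ _ _ _ _ _ _ W0).
Qed.

Lemma normal_partE (w : 'rV[R]_m) : exists a b : R,
  normal_part s X p w = w - a *: dx X p - b *: dy X p.
Proof. by rewrite /normal_part; eexists; eexists; reflexivity. Qed.

Lemma normal_part0 : normal_part s X p 0 = 0.
Proof. rewrite normal_part_projection; exact: gram_projection0. Qed.

End NormalPart.

Section GraphForms.
Context {R : realType} {n : nat}.
Implicit Types (f : R * R -> 'rV[R]_n) (A : set (R * R)) (eps : R).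

(** The Euclidean and the pseudo-Euclidean signatures for [eps = 1] and
    [eps = -1]; one family of lemmas then serves both directions of the
    correspondence. *)
Definition signature eps (i : 'I_(2 + n)) : R := if (i < 2)%N then 1 else eps.

Lemma euclidean_signature : @euclidean_sig R n = signature 1.
Proof. by apply/funext => i; rewrite /signature; case: ifP. Qed.

Lemma pseudo_signature : @pseudo_sig R n = signature (-1).
Proof. by []. Qed.

Lemma mdot_row_mx eps (a b : 'I_2 -> R) (u v : 'I_n -> R) :
  mdot (signature eps) (row_mx (\row_i a i) (\row_k u k))
    (row_mx (\row_i b i) (\row_k v k)) =
  a 0 * b 0 + a 1 * b 1 + eps * \sum_k u k * v k.
Proof.
rewrite /mdot big_split_ord/=; congr (_ + _).
  rewrite !big_ord_recl big_ord0 addr0 !row_mxEl !mxE /signature/= !mul1r.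
  by congr (_ + a _ * b _); apply/val_inj.
rewrite mulr_sumr; apply: eq_bigr => k _.
by rewrite !row_mxEr !mxE /signature/= mulrA.
Qed.

Lemma row_mx0_combination (a b c : R) (u v x : 'I_n -> R) :
  a *: row_mx (0 : 'rV_2) (\row_k u k) - b *: row_mx 0 (\row_k v k)
    + c *: row_mx 0 (\row_k x k) =
  row_mx 0 (\row_k (a * u k - b * v k + c * x k)).
Proof.
rewrite !scale_row_mx opp_row_mx !add_row_mx !scaler0 oppr0 !addr0.
by congr row_mx; apply/rowP => k; rewrite !mxE.
Qed.

(** The horizontal coordinates of a tangent vector determine it, so a tangent
    vector that is vertical is zero. *)
Lemma vertical_normal_eq0 (a b : R) (h u v : 'I_n -> R) :
  row_mx (0 : 'rV_2) (\row_k h k)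
    - a *: row_mx (\row_i (i == 0)%:R) (\row_k u k)
    - b *: row_mx (\row_i (i != 0)%:R) (\row_k v k) = 0 ->
  forall k, h k = 0.
Proof.
rewrite !scale_row_mx !opp_row_mx !add_row_mx -row_mx0 => /eq_row_mx[/rowP H K] k.
have a0 : a = 0.
  by have := H 0; rewrite !mxE/= mulr1 mulr0 sub0r subr0 => /eqP; rewrite oppr_eq0 => /eqP.
have b0 : b = 0.
  by have := H 1; rewrite !mxE/= mulr1 mulr0 subrr sub0r => /eqP; rewrite oppr_eq0 => /eqP.
by move/rowP: K => /(_ k); rewrite a0 b0 !scale0r !subr0 !mxE.
Qed.

Lemma graph_entryl f i : (fun q => graph_map f q 0 (lshift n i)) =
  if i == 0 then (fun q : R * R => q.1) else (fun q : R * R => q.2).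
Proof.
by apply/funext => q; rewrite /graph_map row_mxEl mxE; case: (i == 0).
Qed.

Lemma graph_entryr f k :
  (fun q => graph_map f q 0 (rshift 2 k)) = component f k.
Proof. by apply/funext => q; rewrite /graph_map row_mxEr. Qed.

Lemma C2_on_component A f : open A ->
  C2_on A f <-> forall k, C2_on A (component f k).
Proof.
move=> oA; split=> [/(C2_on_entries f oA) H k|H]; first exact: H.
by apply/(C2_on_entries f oA) => i j; rewrite (ord1 i); exact: H.
Qed.

Lemma C2_on_graph A f : open A -> C2_on A f -> C2_on A (graph_map f).
Proof.
move=> oA /(C2_on_component f oA) H; apply/(C2_on_entries _ oA) => i j.
rewrite (ord1 i) -(fintype.splitK j); case: (fintype.split j) => [l|k]/=.
  by rewrite graph_entryl; case: ifP => _; [exact: C2_on_fst|exact: C2_on_snd].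
by rewrite graph_entryr; exact: H.
Qed.

Lemma graph_first_partials A f p : open A -> C2_on A f -> A p ->
  dx (graph_map f) p = row_mx (\row_i (i == 0)%:R) (\row_k dx (component f k) p)
  /\
  dy (graph_map f) p = row_mx (\row_i (i != 0)%:R) (\row_k dy (component f k) p).
Proof.
move=> oA fC Ap; have [X1 _ _] := C2_on_graph oA fC.
split; apply/rowP => j; rewrite -(fintype.splitK j); case: (fintype.split j) => [l|k]/=.
- rewrite row_mxEl mxE (dx_entry _ _ X1 Ap) graph_entryl.
  by case: ifP => _; rewrite ?dx_fst ?dx_snd.
- by rewrite row_mxEr mxE (dx_entry _ _ X1 Ap) graph_entryr.
- rewrite row_mxEl mxE (dy_entry _ _ X1 Ap) graph_entryl.
  by case: ifP => _; rewrite ?dy_fst ?dy_snd.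
- by rewrite row_mxEr mxE (dy_entry _ _ X1 Ap) graph_entryr.
Qed.

Lemma graph_second_partials A f p : open A -> C2_on A f -> A p ->
  [/\ dx (dx (graph_map f)) p = row_mx 0 (\row_k dx (dx (component f k)) p),
      dx (dy (graph_map f)) p = row_mx 0 (\row_k dx (dy (component f k)) p) &
      dy (dy (graph_map f)) p = row_mx 0 (\row_k dy (dy (component f k)) p)].
Proof.
move=> oA fC Ap; have XC := C2_on_graph oA fC.
split.
- apply/rowP => j; have [exx _ _] := second_partials_entry 0 j oA XC Ap.
  rewrite exx -(fintype.splitK j); case: (fintype.split j) => [l|k]/=.
    by rewrite row_mxEl mxE graph_entryl; case: ifP => _; rewrite ?dx_fst ?dx_snd dx_cst.
  rewrite graph_entryr row_mxEr mxE; reflexivity.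
- apply/rowP => j; have [_ exy _] := second_partials_entry 0 j oA XC Ap.
  rewrite exy -(fintype.splitK j); case: (fintype.split j) => [l|k]/=.
    by rewrite row_mxEl mxE graph_entryl; case: ifP => _; rewrite ?dy_fst ?dy_snd dx_cst.
  rewrite graph_entryr row_mxEr mxE; reflexivity.
- apply/rowP => j; have [_ _ eyy] := second_partials_entry 0 j oA XC Ap.
  rewrite eyy -(fintype.splitK j); case: (fintype.split j) => [l|k]/=.
    by rewrite row_mxEl mxE graph_entryl; case: ifP => _; rewrite ?dy_fst ?dy_snd dy_cst.
  rewrite graph_entryr row_mxEr mxE; reflexivity.
Qed.

Definition grad_xx f p := \sum_k dx (component f k) p * dx (component f k) p.
Definition grad_xy f p := \sum_k dx (component f k) p * dy (component f k) p.
Definition grad_yy f p := \sum_k dy (component f k) p * dy (component f k) p.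

Definition graphE eps f p := 1 + eps * grad_xx f p.
Definition graphF eps f p := eps * grad_xy f p.
Definition graphG eps f p := 1 + eps * grad_yy f p.
Definition graph_gram eps f p :=
  graphE eps f p * graphG eps f p - graphF eps f p ^+ 2.

Lemma graph_first_form eps A f p : open A -> C2_on A f -> A p ->
  [/\ ffE (signature eps) (graph_map f) p = graphE eps f p,
      ffF (signature eps) (graph_map f) p = graphF eps f p &
      ffG (signature eps) (graph_map f) p = graphG eps f p].
Proof.
move=> oA fC Ap; have [ex ey] := graph_first_partials oA fC Ap.
rewrite /ffE /ffF /ffG ex ey; split.
- by rewrite mdot_row_mx mulr1 mulr0 addr0.
- by rewrite mdot_row_mx mulr0 mul0r addr0 add0r.
- by rewrite mdot_row_mx mulr1 mulr0 add0r.
Qed.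

(** The left-hand side of the minimal or maximal surface equation. *)
Definition graph_operator eps f p k :=
  graphG eps f p * dx (dx (component f k)) p
  - 2 * graphF eps f p * dx (dy (component f k)) p
  + graphE eps f p * dy (dy (component f k)) p.

Lemma quadratic_form_gt0 (a b c : R) :
  (forall v : R * R, v != 0 ->
     0 < a * v.1 ^+ 2 + 2 * b * v.1 * v.2 + c * v.2 ^+ 2) <->
  0 < a /\ 0 < a * c - b ^+ 2.
Proof.
split=> [H|[a0 D0] [v1 v2] v0 /=].
- have a0 : 0 < a.
    have := H (1, 0); rewrite /= expr1n expr0n/= !mulr0 !addr0 mulr1; apply.
    by rewrite xpair_eqE oner_eq0.
  (* At [(- b, a)] the form takes the value [a * (a * c - b ^+ 2)]. *)
  split => //; have := H (- b, a); rewrite /= xpair_eqE (gt_eqF a0) andbF.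
  move=> /(_ isT) H1; rewrite -(pmulr_rgt0 _ a0).
  by move: H1; congr (0 < _); ring.
- rewrite -(pmulr_rgt0 _ a0).
  have -> : a * (a * v1 ^+ 2 + 2 * b * v1 * v2 + c * v2 ^+ 2) =
    (a * v1 + b * v2) ^+ 2 + (a * c - b ^+ 2) * v2 ^+ 2 by ring.
  have [v20|v20] := eqVneq v2 0.
    have v10 : v1 != 0 by apply: contra_neq v0 => ->; rewrite v20.
    rewrite v20 mulr0 addr0 expr0n/= mulr0 addr0 exprn_even_gt0//=.
    by rewrite mulf_neq0// gt_eqF.
  by rewrite ltr_wpDl ?sqr_ge0// mulr_gt0// exprn_even_gt0.
Qed.

(** The second derivatives of a graph are vertical, so that the mean curvature
    vector is a multiple of the normal part of the vertical vector with entries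
    [graph_operator eps f p k]. *)
Lemma mean_curvature_graph_eq0 eps A f p : open A -> C2_on A f -> A p ->
  graph_gram eps f p != 0 ->
  mean_curvature_vector (signature eps) (graph_map f) p = 0 <->
  forall k, graph_operator eps f p k = 0.
Proof.
move=> oA fC Ap W0.
have [EE EF EG] := graph_first_form eps oA fC Ap.
have [exx exy eyy] := graph_second_partials oA fC Ap.
have [ex ey] := graph_first_partials oA fC Ap.
have EW : gram (signature eps) (graph_map f) p = graph_gram eps f p.
  by rewrite /gram EE EF EG.
pose h : 'rV[R]_n := \row_k graph_operator eps f p k.
pose w : 'rV[R]_(2 + n) := row_mx 0 h.
have -> : mean_curvature_vector (signature eps) (graph_map f) p =
    (2 * graph_gram eps f p)^-1 *: normal_part (signature eps) (graph_map f) p w.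
  have gW0 : gram (signature eps) (graph_map f) p != 0 by rewrite EW.
  rewrite (mean_curvature_vectorE gW0 exx exy eyy) EW EE EF EG.
  rewrite row_mx0_combination; reflexivity.
split=> [|H].
- move=> /eqP; rewrite scaler_eq0 invr_eq0 mulf_eq0 pnatr_eq0/= (negbTE W0)/=.
  have [a [b ->]] := normal_partE (signature eps) (graph_map f) p w.
  by rewrite ex ey => /eqP; exact: vertical_normal_eq0.
- have -> : w = 0.
    by rewrite /w -row_mx0; congr row_mx; apply/rowP => k; rewrite !mxE.
  by rewrite normal_part0 scaler0.
Qed.

Lemma zero_mean_curvature_graphP eps A f : open A -> C2_on A f ->
  zero_mean_curvature_surface (signature eps) A (graph_map f) <->
  forall p, A p -> [/\ 0 < graphE eps f p, 0 < graph_gram eps f p &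
    forall k, graph_operator eps f p k = 0].
Proof.
move=> oA fC; split=> [[_ Hpos HH] p Ap|H].
- have [EE EF EG] := graph_first_form eps oA fC Ap.
  have /quadratic_form_gt0 : forall v : R * R, v != 0 -> 0 < graphE eps f p *
      v.1 ^+ 2 + 2 * graphF eps f p * v.1 * v.2 + graphG eps f p * v.2 ^+ 2.
    by move=> v /(Hpos p Ap); rewrite /induced_metric EE EF EG.
  move=> [E0 W0]; split => //.
  apply/(mean_curvature_graph_eq0 oA fC Ap); first exact: lt0r_neq0.
  exact: HH.
- split; first exact: C2_on_graph.
  + move=> p Ap v v0; have [E0 W0 _] := H p Ap.
    have [EE EF EG] := graph_first_form eps oA fC Ap.
    by rewrite /induced_metric EE EF EG; apply/quadratic_form_gt0: v v0.
  + move=> p Ap; have [E0 W0 Hk] := H p Ap.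
    by apply/(mean_curvature_graph_eq0 oA fC Ap) => //; exact: lt0r_neq0.
Qed.

Lemma jacobian_norm_sqr f p :
  jacobian_norm f p ^+ 2 = grad_xx f p * grad_yy f p - grad_xy f p ^+ 2.
Proof.
rewrite /jacobian_norm sqr_sqrtr; last first.
  by apply: sumr_ge0 => i _; apply: sumr_ge0 => j _; exact: sqr_ge0.
exact: (Lagrange_identity (fun k => dx (component f k) p)
  (fun k => dy (component f k) p)).
Qed.

End GraphForms.

(** * Pointwise algebra of the twin relations *)

Section TwinAlgebra.
Context {R : realType} {n : nat}.
Implicit Types (f g : R * R -> 'rV[R]_n) (p : R * R) (eps : R).

Definition area_density eps f p := Num.sqrt (graph_gram eps f p).

(** Normalised by the area element, the metric coefficients have determinant 1
    and depend only on the conformal class of the metric; twins share them. *)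
Definition conformalE eps f p := graphE eps f p / area_density eps f p.
Definition conformalF eps f p := graphF eps f p / area_density eps f p.
Definition conformalG eps f p := graphG eps f p / area_density eps f p.

(** For [eps = 1] these are the twin relations, and for [eps = -1] the inverse
    twin relations with [f] and [g] exchanged. *)
Definition twin_at eps f g p : Prop := forall k : 'I_n,
  dx (component g k) p = - eps *
    (conformalE eps f p * dy (component f k) p - conformalF eps f p * dx (component f k) p)
  /\
  dy (component g k) p = eps *
    (conformalG eps f p * dx (component f k) p - conformalF eps f p * dy (component f k) p).

(** The squared sine of the area angle. *)
Definition defect f p := 1 - jacobian_norm f p ^+ 2.

Lemma defect_gt0 f p : jacobian_norm f p < 1 -> 0 < defect f p.
Proof.
move=> J1; have J0 : 0 <= jacobian_norm f p by exact: sqrtr_ge0.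
by rewrite /defect subr_gt0 expr_lt1.
Qed.

Lemma twin_inversion (eps a b c x y : R) : eps = 1 \/ eps = -1 ->
  a * c - b ^+ 2 = 1 ->
  x = - - eps * (a * (eps * (c * x - b * y)) - b * (- eps * (a * y - b * x))) /\
  y = - eps * (c * (- eps * (a * y - b * x)) - b * (eps * (c * x - b * y))).
Proof.
move=> eps1 abc.
have xE : x = (a * c - b ^+ 2) * x by rewrite abc mul1r.
have yE : y = (a * c - b ^+ 2) * y by rewrite abc mul1r.
by split; [rewrite [LHS]xE|rewrite [LHS]yE]; case: eps1 => ->; ring.
Qed.

Lemma conformal_coef_det eps f p : 0 < graph_gram eps f p ->
  conformalE eps f p * conformalG eps f p - conformalF eps f p ^+ 2 = 1.
Proof.
move=> W0; have : area_density eps f p ^+ 2 = graphE eps f p * graphG eps f p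
    - graphF eps f p ^+ 2 by rewrite sqr_sqrtr// ltW.
have : area_density eps f p != 0 by rewrite lt0r_neq0// sqrtr_gt0.
rewrite /conformalE /conformalF /conformalG.
move: (area_density eps f p) (graphE eps f p) (graphF eps f p) (graphG eps f p).
move=> w E F G w0 HW.
by rewrite mulf_div -expr2 expr_div_n -mulrBl -HW divff// expf_neq0.
Qed.

Section Pointwise.
Variables (eps : R) (f g : R * R -> 'rV[R]_n) (p : R * R).
Hypothesis eps1 : eps = 1 \/ eps = -1.
Hypothesis W0 : 0 < graph_gram eps f p.
Hypothesis fg : twin_at eps f g p.

Let E := graphE eps f p.
Let F := graphF eps f p.
Let G := graphG eps f p.
Let W := graph_gram eps f p.
Let w := area_density eps f p.

Let w_sqr : w ^+ 2 = W. Proof. by rewrite sqr_sqrtr// ltW. Qed.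
Let w_gt0 : 0 < w. Proof. by rewrite sqrtr_gt0. Qed.
Let w_neq0 : w != 0. Proof. exact: lt0r_neq0. Qed.

Let W_def : W = E * G - F ^+ 2. Proof. by []. Qed.

(** The gradient of [g] is the image of the gradient of [f] under a matrix of
    determinant [eps ^ 2 * (E G - F ^ 2) / w ^ 2 = 1]. *)
Lemma twin_jacobian_det i j : jacobian_det g i j p = jacobian_det f i j p.
Proof.
rewrite /jacobian_det; have [-> ->] := fg i; have [-> ->] := fg j.
rewrite /conformalE /conformalF /conformalG -/E -/F -/G -/w; have := W_def; rewrite -w_sqr => HW.
set x1 := dx (component f i) p; set x2 := dx (component f j) p.
set y1 := dy (component f i) p; set y2 := dy (component f j) p.
have -> : - eps * (E / w * y1 - F / w * x1) * (eps * (G / w * x2 - F / w * y2))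
  - eps * (G / w * x1 - F / w * y1) * (- eps * (E / w * y2 - F / w * x2)) =
  eps ^+ 2 * ((E * G - F ^+ 2) / w ^+ 2) * (x1 * y2 - y1 * x2) by field.
rewrite -HW divff ?expf_neq0// mulr1.
by case: eps1 => ->; rewrite ?sqrrN expr1n mul1r.
Qed.

Lemma twin_jacobian_norm : jacobian_norm g p = jacobian_norm f p.
Proof.
rewrite /jacobian_norm; congr Num.sqrt; apply: eq_bigr => i _.
by apply: eq_bigr => j _; rewrite twin_jacobian_det.
Qed.

Let defectE : defect f p =
  1 - (grad_xx f p * grad_yy f p - grad_xy f p ^+ 2).
Proof. by rewrite /defect jacobian_norm_sqr. Qed.

(** The products of the derivatives of [g] are quadratic in [E], [F], [G]; the
    common factor appears through the identity [E + G - W = defect f p], valid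
    since [eps ^ 2 = 1]. *)
Lemma twin_first_form :
  [/\ graphE (- eps) g p = E * (defect f p / W),
      graphF (- eps) g p = F * (defect f p / W) &
      graphG (- eps) g p = G * (defect f p / W)].
Proof.
have gx k : dx (component g k) p = eps * F / w * dx (component f k) p
    + (- eps * E / w) * dy (component f k) p.
  by have [-> _] := fg k; rewrite /conformalE /conformalF -/E -/F -/w; ring.
have gy k : dy (component g k) p = eps * G / w * dx (component f k) p
    + (- eps * F / w) * dy (component f k) p.
  by have [_ ->] := fg k; rewrite /conformalG /conformalF -/F -/G -/w; ring.
have combine (a b c d : R) : \sum_k
    (a * dx (component f k) p + b * dy (component f k) p) *
    (c * dx (component f k) p + d * dy (component f k) p) =
    a * c * grad_xx f p + (a * d + b * c) * grad_xy f p + b * d * grad_yy f p.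
  exact: sum_bilinear.
have exx : grad_xx g p = (F ^+ 2 * grad_xx f p - 2 * E * F * grad_xy f p
    + E ^+ 2 * grad_yy f p) / W.
  rewrite [grad_xx g p](eq_bigr _ (fun k _ => congr2 *%R (gx k) (gx k))).
  rewrite combine -w_sqr.
  move: (grad_xx f p) (grad_xy f p) (grad_yy f p) E F G w w_neq0.
  by move=> a b c E' F' G' w' w'0; case: eps1 => ->; field.
have exy : grad_xy g p = (F * G * grad_xx f p - (F ^+ 2 + E * G) * grad_xy f p
    + E * F * grad_yy f p) / W.
  rewrite [grad_xy g p](eq_bigr _ (fun k _ => congr2 *%R (gx k) (gy k))).
  rewrite combine -w_sqr.
  move: (grad_xx f p) (grad_xy f p) (grad_yy f p) E F G w w_neq0.
  by move=> a b c E' F' G' w' w'0; case: eps1 => ->; field.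
have eyy : grad_yy g p = (G ^+ 2 * grad_xx f p - 2 * F * G * grad_xy f p
    + F ^+ 2 * grad_yy f p) / W.
  rewrite [grad_yy g p](eq_bigr _ (fun k _ => congr2 *%R (gy k) (gy k))).
  rewrite combine -w_sqr.
  move: (grad_xx f p) (grad_xy f p) (grad_yy f p) E F G w w_neq0.
  by move=> a b c E' F' G' w' w'0; case: eps1 => ->; field.
have Wn0 : W != 0 by exact: lt0r_neq0.
have HW := W_def.
rewrite defectE /graphE /graphF /graphG exx exy eyy.
have key (x y d : R) : x * W = y * d -> x = y * (d / W).
  by move=> xW; rewrite mulrA -xW mulfK.
rewrite /E /F /G /graphE /graphF /graphG in HW *.
move: (grad_xx f p) (grad_xy f p) (grad_yy f p) HW => a b c HW.
split; apply: key.
- rewrite mulrDl mul1r -(mulrA (- eps)) divfK// HW; case: eps1 => ->; ring.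
- rewrite -(mulrA (- eps)) divfK//; case: eps1 => ->; ring.
- rewrite mulrDl mul1r -(mulrA (- eps)) divfK// HW; case: eps1 => ->; ring.
Qed.

Lemma twin_gram : graph_gram (- eps) g p = defect f p ^+ 2 / W.
Proof.
rewrite /graph_gram; have [-> -> ->] := twin_first_form.
have Wn0 : W != 0 by exact: lt0r_neq0.
have -> : E * (defect f p / W) * (G * (defect f p / W)) -
  (F * (defect f p / W)) ^+ 2 = (E * G - F ^+ 2) * (defect f p / W) ^+ 2 by ring.
by rewrite -W_def; field.
Qed.

Hypothesis J1 : jacobian_norm f p < 1.

Lemma twin_area_density : area_density (- eps) g p = defect f p / w.
Proof.
have D0 := defect_gt0 J1.
rewrite /area_density twin_gram -w_sqr -expr_div_n sqrtr_sqr ger0_norm//.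
by rewrite divr_ge0// ltW.
Qed.

(** By conformality the coefficients computed from [g] are those computed from
    [f]; as they have determinant 1, the linear system inverts with the same
    coefficients and the opposite sign. *)
Lemma twin_sym : twin_at (- eps) g f p.
Proof.
have Dn0 : defect f p != 0 by exact/lt0r_neq0/defect_gt0.
have Wn0 : W != 0 by exact: lt0r_neq0.
have [eE eF eG] := twin_first_form; have eW := twin_area_density.
have cancel (x : R) : x * (defect f p / w ^+ 2) / (defect f p / w) = x / w.
  by move: (defect f p) w w_neq0 Dn0 => d w' w0 d0; field; apply/andP.
have cE : conformalE (- eps) g p = conformalE eps f p.
  rewrite /conformalE eE eW -w_sqr; exact: cancel.
have cF : conformalF (- eps) g p = conformalF eps f p.
  rewrite /conformalF eF eW -w_sqr; exact: cancel.
have cG : conformalG (- eps) g p = conformalG eps f p.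
  rewrite /conformalG eG eW -w_sqr; exact: cancel.
have cW := conformal_coef_det W0.
move=> k; rewrite cE cF cG; have [-> ->] := fg k.
exact: twin_inversion.
Qed.

End Pointwise.

End TwinAlgebra.

(** * The conformal coefficients of a zero mean curvature graph *)

Section Conformal.
Context {R : realType}.

(** Here [a1], [a2], [a3] stand for the products of [f_x] with [f_xx], [f_xy],
    [f_yy], and [b1], [b2], [b3] for those of [f_y]. The two linear hypotheses are
    the zero mean curvature equation contracted with [f_x] and with [f_y], and
    both conclusions are combinations of them. *)
Lemma conformal_identity (E F G a1 a2 a3 b1 b2 b3 eps w : R) :
  w ^+ 2 = E * G - F ^+ 2 -> w != 0 ->
  G * a1 - 2 * F * a2 + E * a3 = 0 ->
  G * b1 - 2 * F * b2 + E * b3 = 0 ->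
  let Ex := eps * (2 * a1) in let Ey := eps * (2 * a2) in
  let Fx := eps * (b1 + a2) in let Fy := eps * (b2 + a3) in
  let Gx := eps * (2 * b2) in let Gy := eps * (2 * b3) in
  let Wx := Ex * G + E * Gx - 2 * F * Fx in
  let Wy := Ey * G + E * Gy - 2 * F * Fy in
  let wx := (2 * w)^-1 * Wx in let wy := (2 * w)^-1 * Wy in
  Gx * w^-1 + G * - (w ^- 2 * wx) = Fy * w^-1 + F * - (w ^- 2 * wy) /\
  Ey * w^-1 + E * - (w ^- 2 * wy) = Fx * w^-1 + F * - (w ^- 2 * wx).
Proof.
move=> HW w0 Ha Hb /=.
have reduce (X Y x y : R) wx wy :
    (X - Y) * (2 * w ^+ 2) - (x * wx - y * wy) = 0 ->
    X * w^-1 + x * - (w ^- 2 * ((2 * w)^-1 * wx)) =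
    Y * w^-1 + y * - (w ^- 2 * ((2 * w)^-1 * wy)).
  move=> H; apply/eqP; rewrite -subr_eq0; apply/eqP.
  transitivity (((X - Y) * (2 * w ^+ 2) - (x * wx - y * wy)) / (2 * w ^+ 3)).
    by field.
  by rewrite H mul0r.
split; apply: reduce; rewrite HW.
- transitivity (2 * eps * (F * (G * b1 - 2 * F * b2 + E * b3)
    - G * (G * a1 - 2 * F * a2 + E * a3))); first ring.
  by rewrite Ha Hb; ring.
- transitivity (2 * eps * (F * (G * a1 - 2 * F * a2 + E * a3)
    - E * (G * b1 - 2 * F * b2 + E * b3))); first ring.
  by rewrite Ha Hb; ring.
Qed.


Lemma weighted_sum_eq0 n (z r s t : 'I_n -> R) (a b c : R) :
  (forall k, a * r k - 2 * b * s k + c * t k = 0) ->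
  a * (\sum_k z k * r k) - 2 * b * (\sum_k z k * s k) +
    c * (\sum_k z k * t k) = 0.
Proof.
move=> H; rewrite !mulr_sumr -sumrB -big_split/=; apply: big1 => k _.
by rewrite -[RHS](mulr0 (z k)) -(H k); ring.
Qed.

Lemma is_potential_C1_on (A : set (R * R)) (P Q u : R * R -> R) : open A ->
  is_potential A P Q u -> (forall p, A p -> {for p, continuous P}) ->
  (forall p, A p -> {for p, continuous Q}) -> C1_on A u.
Proof.
move=> oA Hu cP cQ p Ap; have [[dux _] [duy _]] := Hu p Ap.
split; [exact: dux|exact: duy| |].
- apply: near_eq_cont (cP p Ap); near=> q; apply/esym.
  have Aq : A q by near: q; exact: open_near.
  by have [[_ e] _] := Hu q Aq; exact: e.
- apply: near_eq_cont (cQ p Ap); near=> q; apply/esym.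
  have Aq : A q by near: q; exact: open_near.
  by have [_ [_ e]] := Hu q Aq; exact: e.
Unshelve. all: by end_near. Qed.

Lemma C1_on_is_potential (A : set (R * R)) (u : R * R -> R) :
  C1_on A u -> is_potential A (dx u) (dy u) u.
Proof.
by move=> uC p Ap; have [d1 d2 _ _] := uC p Ap; split; exact: DeriveDef.
Qed.

Lemma C2_partials (A : set (R * R)) (u : R * R -> R) : open A -> C2_on A u ->
  has_C1_partials A (dx u) (dx (dx u)) (dx (dy u)) /\
  has_C1_partials A (dy u) (dx (dy u)) (dy (dy u)).
Proof.
move=> oA [uC uxC uyC].
have Hx : has_C1_partials A (dx u) (dx (dx u)) (dy (dx u)).
  apply: (C1_on_has_C1_partials uxC) => p Ap.
  by have [_ _ c _] := uC p Ap; exact: c.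
have Hy : has_C1_partials A (dy u) (dx (dy u)) (dy (dy u)).
  apply: (C1_on_has_C1_partials uyC) => p Ap.
  by have [_ _ _ c] := uC p Ap; exact: c.
split; last exact: Hy.
apply: (has_C1_partials_eq oA _ _ _ Hx) => p Ap; [reflexivity..|].
exact: symmetry_of_second_partials oA (C1_on_is_potential uC) Hx Hy _ Ap.
Qed.

End Conformal.

Section ConformalCoefficients.
Context {R : realType} {n : nat}.
Implicit Types (f g : R * R -> 'rV[R]_n) (p : R * R) (eps : R) (A : set (R * R)).

(** The two equations express that the horizontal coordinates are harmonic
    functions for the induced metric. *)
Lemma conformal_coefficients eps A f : open A -> C2_on A f ->
  (forall p, A p -> 0 < graph_gram eps f p /\
     forall k, graph_operator eps f p k = 0) ->
  exists Ex Ey Fx Fy Gx Gy : R * R -> R,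
    [/\ has_C1_partials A (conformalE eps f) Ex Ey,
        has_C1_partials A (conformalF eps f) Fx Fy,
        has_C1_partials A (conformalG eps f) Gx Gy &
        forall p, A p -> Gx p = Fy p /\ Ey p = Fx p].
Proof.
move=> oA /(C2_on_component f oA) fC H.
pose x k := dx (component f k); pose y k := dy (component f k).
pose xx k := dx (dx (component f k)); pose xy k := dx (dy (component f k)).
pose yy k := dy (dy (component f k)).
have Hx k : has_C1_partials A (x k) (xx k) (xy k).
  by have [Hx _] := C2_partials oA (fC k).
have Hy k : has_C1_partials A (y k) (xy k) (yy k).
  by have [_ Hy] := C2_partials oA (fC k).
pose a1 p := \sum_k x k p * xx k p; pose a2 p := \sum_k x k p * xy k p.
pose a3 p := \sum_k x k p * yy k p.
pose b1 p := \sum_k y k p * xx k p; pose b2 p := \sum_k y k p * xy k p.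
pose b3 p := \sum_k y k p * yy k p.
have affine (c : R) (u ux uy vx vy : R * R -> R) : has_C1_partials A u ux uy ->
    (forall p, A p -> ux p = vx p) -> (forall p, A p -> uy p = vy p) ->
    has_C1_partials A (fun p => c + eps * u p) (fun p => eps * vx p)
      (fun p => eps * vy p).
  move=> Hu ex ey; apply: (has_C1_partials_eq oA _ _ _ (has_C1_partialsD
    (has_C1_partials_cst c)
    (has_C1_partialsM (has_C1_partials_cst eps) Hu))) => p Ap /=.
  - reflexivity.
  - by rewrite mul0r !add0r ex.
  - by rewrite mul0r !add0r ey.
have HE : has_C1_partials A (graphE eps f) (fun p => eps * (2 * a1 p))
    (fun p => eps * (2 * a2 p)).
  apply: (affine _ _ _ _ _ _
    (has_C1_partials_sum (fun k => has_C1_partialsM (Hx k) (Hx k)))).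
    by move=> p _; rewrite mulr_sumr; apply: eq_bigr => k _; ring.
  by move=> p _; rewrite mulr_sumr; apply: eq_bigr => k _; ring.
have HG : has_C1_partials A (graphG eps f) (fun p => eps * (2 * b2 p))
    (fun p => eps * (2 * b3 p)).
  apply: (affine _ _ _ _ _ _
    (has_C1_partials_sum (fun k => has_C1_partialsM (Hy k) (Hy k)))).
    by move=> p _; rewrite mulr_sumr; apply: eq_bigr => k _; ring.
  by move=> p _; rewrite mulr_sumr; apply: eq_bigr => k _; ring.
have HF : has_C1_partials A (graphF eps f) (fun p => eps * (b1 p + a2 p))
    (fun p => eps * (b2 p + a3 p)).
  have HF0 := affine 0 _ _ _ (fun p => b1 p + a2 p) (fun p => b2 p + a3 p)
    (has_C1_partials_sum (fun k => has_C1_partialsM (Hx k) (Hy k))).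
  apply: (has_C1_partials_eq oA _ _ _ (HF0 _ _)) => p _ /=.
  - by rewrite add0r.
  - reflexivity.
  - reflexivity.
  - by rewrite -big_split; apply: eq_bigr => k _ /=; ring.
  - by rewrite -big_split; apply: eq_bigr => k _ /=; ring.
pose Wx p := eps * (2 * a1 p) * graphG eps f p + graphE eps f p * (eps * (2 * b2 p))
  - 2 * graphF eps f p * (eps * (b1 p + a2 p)).
pose Wy p := eps * (2 * a2 p) * graphG eps f p + graphE eps f p * (eps * (2 * b3 p))
  - 2 * graphF eps f p * (eps * (b2 p + a3 p)).
have HW : has_C1_partials A (graph_gram eps f) Wx Wy.
  apply: (has_C1_partials_eq oA _ _ _ (has_C1_partialsD (has_C1_partialsM HE HG)
    (has_C1_partialsM (has_C1_partials_cst (-1)) (has_C1_partialsM HF HF))))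
    => p _ /=.
  - by rewrite /graph_gram mulN1r expr2.
  - by rewrite /Wx; ring.
  - by rewrite /Wy; ring.
have w0 p : A p -> area_density eps f p != 0.
  by move=> /H[W0 _]; apply: lt0r_neq0; rewrite sqrtr_gt0.
have Hw := has_C1_partialsV w0 (has_C1_partials_sqrt (fun p Ap => (H p Ap).1) HW).
eexists; eexists; eexists; eexists; eexists; eexists; split.
- exact: has_C1_partialsM HE Hw.
- exact: has_C1_partialsM HF Hw.
- exact: has_C1_partialsM HG Hw.
move=> p Ap /=; have [W0 Hk] := H p Ap.
apply: (@conformal_identity _ (graphE eps f p) (graphF eps f p) (graphG eps f p)
  (a1 p) (a2 p) (a3 p) (b1 p) (b2 p) (b3 p) eps (area_density eps f p)).
- by rewrite sqr_sqrtr// ltW.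
- exact: w0.
- exact: (weighted_sum_eq0 (fun k => x k p) Hk).
- exact: (weighted_sum_eq0 (fun k => y k p) Hk).
Qed.

End ConformalCoefficients.

(** * Existence of twins *)

Section TwinSurfaces.
Context {R : realType} {n : nat}.
Implicit Types (f g : R * R -> 'rV[R]_n) (p : R * R) (eps : R) (A : set (R * R)).

Lemma has_C1_partials_cross A (c : R)
    (a ax ay u ux uy b b_x b_y v vx vy : R * R -> R) :
  open A ->
  has_C1_partials A a ax ay -> has_C1_partials A u ux uy ->
  has_C1_partials A b b_x b_y -> has_C1_partials A v vx vy ->
  has_C1_partials A (fun p => c * (a p * u p - b p * v p))
    (fun p => c * (ax p * u p + a p * ux p - (b_x p * v p + b p * vx p)))
    (fun p => c * (ay p * u p + a p * uy p - (b_y p * v p + b p * vy p))).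
Proof.
move=> oA Ha Hu Hb Hv; apply: (has_C1_partials_eq oA _ _ _
  (has_C1_partialsM (has_C1_partials_cst c) (has_C1_partialsD
    (has_C1_partialsM Ha Hu)
    (has_C1_partialsM (has_C1_partials_cst (-1)) (has_C1_partialsM Hb Hv)))))
  => p _ /=; ring.
Qed.

(** The derivatives of the conformal coefficients cancel in the exterior
    derivative of the twin 1-form, which leaves the zero mean curvature equation
    of the component. *)
Lemma exists_twin eps A f : simply_connected_domain A -> C2_on A f ->
  (forall p, A p -> 0 < graph_gram eps f p /\
     forall k, graph_operator eps f p k = 0) ->
  exists g, C2_on A g /\ forall p, A p -> twin_at eps f g p.
Proof.
move=> scA fC H; have [oA _ _ _] := scA.
have [Ex [Ey [Fx [Fy [Gx [Gy [HE HF HG closedEFG]]]]]]] :=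
  conformal_coefficients oA fC H.
have fkC := (C2_on_component f oA).1 fC.
pose P k p := - eps * (conformalE eps f p * dy (component f k) p
  - conformalF eps f p * dx (component f k) p).
pose Q k p := eps * (conformalG eps f p * dx (component f k) p
  - conformalF eps f p * dy (component f k) p).
have HPQ k : exists Px Py Qx Qy, [/\ has_C1_partials A (P k) Px Py,
    has_C1_partials A (Q k) Qx Qy & forall p, A p -> Py p = Qx p].
  have [Hx Hy] := C2_partials oA (fkC k).
  eexists; eexists; eexists; eexists; split.
  - exact: (has_C1_partials_cross (- eps) oA HE Hy HF Hx).
  - exact: (has_C1_partials_cross eps oA HG Hx HF Hy).
  move=> p Ap /=; have [-> ->] := closedEFG p Ap.
  have [W0 /(_ k)] := H p Ap; rewrite /graph_operator.
  rewrite /conformalE /conformalF /conformalG.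
  have w0 : area_density eps f p != 0 by rewrite lt0r_neq0// sqrtr_gt0.
  move: (dx (component f k) p) (dy (component f k) p) (Fx p) (Fy p).
  move: (dx (dx (component f k)) p) (dx (dy (component f k)) p)
    (dy (dy (component f k)) p).
  move: (graphE eps f p) (graphF eps f p) (graphG eps f p) (area_density eps f p) w0.
  move=> E F G w w0 r s t x y Fx' Fy' Hk; apply/eqP; rewrite -subr_eq0; apply/eqP.
  transitivity (- eps / w * (G * r - 2 * F * s + E * t)); first by field.
  by rewrite Hk mulr0.
have /choice[u Hu] k : exists u, is_potential A (P k) (Q k) u.
  have [Px [Py [Qx [Qy [HP HQ PQ]]]]] := HPQ k.
  exact: (global_potential scA (local_potential oA HP HQ PQ)).
pose g p : 'rV[R]_n := \row_k u k p.
have gk k : component g k = u k by apply/funext => p; rewrite /component mxE.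
have dg k p : A p -> dx (component g k) p = P k p /\ dy (component g k) p = Q k p.
  by rewrite gk => /(Hu k)[[_ ex] [_ ey]]; split; [exact: ex|exact: ey].
exists g; split; last first.
  by move=> p Ap k; have [ex ey] := dg k p Ap; split; [exact: ex|exact: ey].
apply/(C2_on_component g oA) => k.
have [Px [Py [Qx [Qy [HP HQ _]]]]] := HPQ k.
split.
- rewrite gk; apply: (is_potential_C1_on oA (Hu k)) => p Ap.
    by have [c _ _ _ _] := HP p Ap; exact: c.
  by have [c _ _ _ _] := HQ p Ap; exact: c.
- apply: (C1_on_eq oA _ (has_C1_partials_C1_on oA HP)) => p Ap; apply/esym.
  by have [ex _] := dg k p Ap; exact: ex.
- apply: (C1_on_eq oA _ (has_C1_partials_C1_on oA HQ)) => p Ap; apply/esym.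
  by have [_ ey] := dg k p Ap; exact: ey.
Qed.

(** Solving the twin relations for the gradient of [f] presents the mixed second
    derivatives of a component of [f] as the two terms of the divergence
    associated with [g], with opposite signs. *)
Lemma twin_operator_eq0 eps A f g : eps = 1 \/ eps = -1 -> open A ->
  C2_on A f -> C2_on A g ->
  (forall p, A p -> 0 < graph_gram eps f p /\
     forall k, graph_operator eps f p k = 0) ->
  (forall p, A p -> twin_at eps f g p) ->
  forall p, A p -> forall k, graph_operator (- eps) g p k = 0.
Proof.
move=> eps1 oA fC gC H fg p Ap k.
have [Ex [Ey [Fx [Fy [Gx [Gy [HE HF HG closedEFG]]]]]]] :=
  conformal_coefficients oA fC H.
have [Hfx Hfy] := C2_partials oA ((C2_on_component f oA).1 fC k).
have [Hgx Hgy] := C2_partials oA ((C2_on_component g oA).1 gC k).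
have solve q : A q ->
   1 * (conformalG eps f q * dx (component g k) q
     - conformalF eps f q * dy (component g k) q) =
   - eps * (1 * dy (component f k) q - 0 * dx (component f k) q) /\
   1 * (conformalE eps f q * dy (component g k) q
     - conformalF eps f q * dx (component g k) q) =
   eps * (1 * dx (component f k) q - 0 * dy (component f k) q).
  move=> Aq; have [W0 _] := H q Aq.
  have := conformal_coef_det W0; have [-> ->] := fg q Aq k.
  move: (dx (component f k) q) (dy (component f k) q).
  move: (conformalE eps f q) (conformalF eps f q) (conformalG eps f q).
  move=> a b c x y abc.
  have xE : x = (a * c - b ^+ 2) * x by rewrite abc mul1r.
  have yE : y = (a * c - b ^+ 2) * y by rewrite abc mul1r.
  by split; [rewrite [in RHS]yE|rewrite [in RHS]xE]; ring.
have H1 := has_C1_partials_cross 1 oA HG Hgx HF Hgy.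
have H2 := has_C1_partials_cross 1 oA HE Hgy HF Hgx.
have K1 := has_C1_partials_cross (- eps) oA (has_C1_partials_cst 1) Hfy
  (has_C1_partials_cst 0) Hfx.
have K2 := has_C1_partials_cross eps oA (has_C1_partials_cst 1) Hfx
  (has_C1_partials_cst 0) Hfy.
have L1 := has_C1_partials_eq oA (fun q Aq => (solve q Aq).1)
  (fun _ _ => erefl) (fun _ _ => erefl) H1.
have L2 := has_C1_partials_eq oA (fun q Aq => (solve q Aq).2)
  (fun _ _ => erefl) (fun _ _ => erefl) H2.
have [M1 _] := has_C1_partialsE L1 Ap; have [N1 _] := has_C1_partialsE K1 Ap.
have [_ M2] := has_C1_partialsE L2 Ap; have [_ N2] := has_C1_partialsE K2 Ap.
have e1 := etrans (esym M1) N1; have e2 := etrans (esym M2) N2.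
have {e1 e2 M1 N1 M2 N2 L1 L2 K1 K2 H1 H2} := congr2 +%R e1 e2.
have [-> ->] := closedEFG p Ap; have [W0 _] := H p Ap.
have [eE eF eG] := twin_first_form eps1 W0 (fg p Ap).
rewrite /graph_operator eE eF eG /conformalE /conformalF /conformalG.
have w0 : area_density eps f p != 0 by rewrite lt0r_neq0// sqrtr_gt0.
move: (dx (component f k) p) (dy (component f k) p) (Fx p) (Fy p).
move: (dx (component g k) p) (dy (component g k) p).
move: (dx (dx (component f k)) p) (dx (dy (component f k)) p)
  (dy (dy (component f k)) p).
move: (dx (dx (component g k)) p) (dx (dy (component g k)) p)
  (dy (dy (component g k)) p).
move: (graphE eps f p) (graphF eps f p) (graphG eps f p) (area_density eps f p) w0.
move: (defect f p / graph_gram eps f p).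
move=> d E F G w w0 r s t r' s' t' x y x' y' Fx' Fy' e.
(* The second factor is the divergence; [d * w] is the ratio between the metric
   coefficients of [g] and the conformal ones. *)
transitivity (d * w * (1 * (Fy' * x + G / w * r - (Fx' * y + F / w * s)) +
  1 * (Fx' * y + E / w * t - (Fy' * x + F / w * s)))); first by field.
by rewrite e; ring.
Qed.

Lemma exists_twin_graph eps A f : eps = 1 \/ eps = -1 ->
  simply_connected_domain A -> area_decreasing A f ->
  zero_mean_curvature_surface (signature eps) A (graph_map f) ->
  exists g, [/\ area_decreasing A g,
    zero_mean_curvature_surface (signature (- eps)) A (graph_map g),
    forall p, A p -> twin_at eps f g p &
    forall p, A p -> jacobian_norm g p = jacobian_norm f p].
Proof.
move=> eps1 scA [fC J1]; have [oA _ _ _] := scA.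
move=> /(zero_mean_curvature_graphP eps oA fC) H.
have H' p : A p -> 0 < graph_gram eps f p /\
    forall k, graph_operator eps f p k = 0.
  by move=> /H[].
have [g [gC fg]] := exists_twin scA fC H'.
have Jg p : A p -> jacobian_norm g p = jacobian_norm f p.
  by move=> Ap; have [W0 _] := H' p Ap; exact: twin_jacobian_norm (fg p Ap).
exists g; split; [|  |exact: fg|exact: Jg].
- by split; [exact: gC|move=> p Ap; rewrite Jg//; exact: J1].
- apply/(zero_mean_curvature_graphP _ oA gC) => p Ap.
  have [E0 W0 _] := H p Ap; have D0 := defect_gt0 (J1 p Ap).
  have [eE _ _] := twin_first_form eps1 W0 (fg p Ap).
  split; last exact: twin_operator_eq0 fg _ Ap.
  + by rewrite eE mulr_gt0// divr_gt0.
  + by rewrite (twin_gram eps1 W0 (fg p Ap)) divr_gt0// exprn_gt0.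
Qed.

End TwinSurfaces.

(** * The twin correspondence *)

Section TwinCorrespondence.
Context {R : realType} {n : nat}.
Implicit Types (f g : R * R -> 'rV[R]_n) (A : set (R * R)).

Lemma graph_area_element eps A f p : open A -> C2_on A f -> A p ->
  area_element (signature eps) (graph_map f) p = area_density eps f p.
Proof.
move=> oA fC Ap; have [eE eF eG] := graph_first_form eps oA fC Ap.
by rewrite /area_element /gram eE eF eG.
Qed.

Lemma twin_relationsP A f g : open A -> C2_on A f ->
  twin_relations A f g <-> forall p, A p -> twin_at 1 f g p.
Proof.
move=> oA fC.
rewrite /twin_relations euclidean_signature.
split=> H p Ap k; have [eE eF eG] := graph_first_form 1 oA fC Ap;
  have eW := graph_area_element 1 oA fC Ap; have := H p Ap k.
  rewrite /= eW eE eF eG => -[-> ->].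
  by rewrite /conformalE /conformalF /conformalG; split; ring.
rewrite /= eW eE eF eG => -[-> ->].
by rewrite /conformalE /conformalF /conformalG; split; ring.
Qed.

Lemma inverse_twin_relationsP A f g : open A -> C2_on A g ->
  inverse_twin_relations A f g <-> forall p, A p -> twin_at (-1) g f p.
Proof.
move=> oA gC.
rewrite /inverse_twin_relations pseudo_signature.
split=> H p Ap k; have [eE eF eG] := graph_first_form (-1) oA gC Ap;
  have eW := graph_area_element (-1) oA gC Ap; have := H p Ap k.
  rewrite /= eW eE eF eG => -[-> ->].
  by rewrite /conformalE /conformalF /conformalG; split; ring.
rewrite /= eW eE eF eG => -[-> ->].
by rewrite /conformalE /conformalF /conformalG; split; ring.
Qed.

Lemma is_area_angle_eq A f g Theta : is_area_angle A f Theta ->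
  (forall p, A p -> jacobian_norm g p = jacobian_norm f p) ->
  is_area_angle A g Theta.
Proof.
by move=> H e p Ap; rewrite /area_angle e//; exact: H.
Qed.

Lemma sin_area_angle f p : jacobian_norm f p < 1 ->
  sin (area_angle f p) ^+ 2 = defect f p.
Proof.
move=> J1; have J0 : 0 <= jacobian_norm f p by exact: sqrtr_ge0.
by rewrite sin2cos2 /area_angle acosK// in_itv/= (ltW J1) (le_trans _ J0)// lerN10.
Qed.

End TwinCorrespondence.

Theorem theorem2p3 (R : realType) (n : nat) (n_ge2 : (2 <= n)%N)
  (Omega : set (R * R)) (sc_Omega : simply_connected_domain Omega) :
  (* (a) *)
  (forall (f : R * R -> 'rV[R]_n) (Theta : R * R -> R),
     area_decreasing Omega f -> is_area_angle Omega f Theta ->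
     minimal_surface Omega (graph_map f) ->
     exists g : R * R -> 'rV[R]_n,
       twin_maximal_graph Omega f g /\ is_area_angle Omega g Theta)
  /\
  (* (b) *)
  (forall (g : R * R -> 'rV[R]_n) (Theta : R * R -> R),
     area_decreasing Omega g -> is_area_angle Omega g Theta ->
     maximal_surface Omega (graph_map g) ->
     exists f : R * R -> 'rV[R]_n,
       twin_minimal_graph Omega g f /\ is_area_angle Omega f Theta)
  /\
  (* (c) *)
  (forall f g : R * R -> 'rV[R]_n,
     area_decreasing Omega f -> minimal_surface Omega (graph_map f) ->
     area_decreasing Omega g -> maximal_surface Omega (graph_map g) ->
     (* (c1) *)
     (twin_relations Omega f g <-> inverse_twin_relations Omega f g)
     /\
     (twin_relations Omega f g ->
      forall p, Omega p ->
        let w := area_element (@euclidean_sig R n) (graph_map f) p in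
        let w' := area_element (@pseudo_sig R n) (graph_map g) p in
        [/\ (* (c2) *)
            area_angle f p = area_angle g p,
            forall i j : 'I_n, jacobian_det f i j p = jacobian_det g i j p,
            (* (c3) *)
            w' * w = sin (area_angle f p) ^+ 2 /\
              0 < sin (area_angle f p) ^+ 2 &
            (* (c4) *)
            forall v : R * R,
              induced_metric (@euclidean_sig R n) (graph_map f) p v =
              w / w' * induced_metric (@pseudo_sig R n) (graph_map g) p v]))
  /\
  (* (d) *)
  (forall f g f' : R * R -> 'rV[R]_n,
     area_decreasing Omega f -> minimal_surface Omega (graph_map f) ->
     twin_maximal_graph Omega f g -> twin_minimal_graph Omega g f' ->
     exists c : 'rV[R]_n, forall p, Omega p -> f' p = f p + c).
Proof.
have [oO neO cO _] := sc_Omega.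
have gram_pos (eps : R) (f : R * R -> 'rV[R]_n) : C2_on Omega f ->
    zero_mean_curvature_surface (signature eps) Omega (graph_map f) ->
    forall p, Omega p -> 0 < graph_gram eps f p.
  by move=> fC /(zero_mean_curvature_graphP eps oO fC) H p /H[].
split; [|split; [|split]].
- move=> f Theta fA fT; rewrite /minimal_surface euclidean_signature => fM.
  have [g [gA gM fg Jg]] := exists_twin_graph (or_introl erefl) sc_Omega fA fM.
  exists g; split; last exact: is_area_angle_eq fT Jg.
  split; [exact: gA|by rewrite /maximal_surface pseudo_signature|].
  by apply/twin_relationsP; [exact: oO|case: fA|exact: fg].
- move=> g Theta gA gT; rewrite /maximal_surface pseudo_signature => gM.
  have [f [fA fM gf Jf]] := exists_twin_graph (or_intror erefl) sc_Omega gA gM.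
  exists f; split; last exact: is_area_angle_eq gT Jf.
  split; [exact: fA| |].
    by rewrite /minimal_surface euclidean_signature -(opprK 1).
  by apply/inverse_twin_relationsP; [exact: oO|case: gA|exact: gf].
- move=> f g [fC fJ]; rewrite /minimal_surface euclidean_signature => fM.
  move=> [gC gJ]; rewrite /maximal_surface pseudo_signature => gM.
  have fW := gram_pos _ _ fC fM; have gW := gram_pos _ _ gC gM.
  split.
    split=> [/(twin_relationsP g oO fC) fg|/(inverse_twin_relationsP f oO gC) gf].
      apply/(inverse_twin_relationsP f oO gC) => p Op.
      exact: (twin_sym (or_introl erefl) (fW p Op) (fg p Op) (fJ p Op)).
    apply/(twin_relationsP g oO fC) => p Op; rewrite -(opprK 1).
    exact: (twin_sym (or_intror erefl) (gW p Op) (gf p Op) (gJ p Op)).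
  move=> /(twin_relationsP g oO fC) fg p Op /=.
  rewrite (graph_area_element 1 oO fC Op).
  rewrite (graph_area_element (-1) oO gC Op).
  rewrite (twin_area_density (or_introl erefl) (fW p Op) (fg p Op) (fJ p Op)).
  have w0 : area_density 1 f p != 0 by rewrite lt0r_neq0// sqrtr_gt0 fW.
  have D0 := defect_gt0 (fJ p Op).
  have Dn0 : defect f p != 0 by exact: lt0r_neq0.
  split.
  + by rewrite /area_angle (twin_jacobian_norm (or_introl erefl) (fW p Op) (fg p Op)).
  + by move=> i j; rewrite (twin_jacobian_det (or_introl erefl) (fW p Op) (fg p Op)).
  + by rewrite sin_area_angle ?fJ// divfK.
  + move=> v; rewrite /induced_metric.
    have [-> -> ->] := graph_first_form 1 oO fC Op.
    have [-> -> ->] := graph_first_form (-1) oO gC Op.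
    have [-> -> ->] := twin_first_form (or_introl erefl) (fW p Op) (fg p Op).
    have W2 : graph_gram 1 f p = area_density 1 f p ^+ 2.
      by rewrite sqr_sqrtr// ltW// fW.
    rewrite W2; move: (graphE 1 f p) (graphF 1 f p) (graphG 1 f p).
    move: (area_density 1 f p) w0 (defect f p) Dn0 => w w0 d d0 E F G.
    by field; apply/andP.
- move=> f g f' [fC fJ]; rewrite /minimal_surface euclidean_signature => fM.
  move=> [[gC _] _ /(twin_relationsP g oO fC) fg].
  move=> [[f'C _] _ /(inverse_twin_relationsP f' oO gC) gf'].
  have fW := gram_pos _ _ fC fM.
  have pot k : is_potential Omega (dx (component f k)) (dy (component f k))
      (component f k).
    by apply: C1_on_is_potential; have [] := (C2_on_component f oO).1 fC k.
  have pot' k : is_potential Omega (dx (component f k)) (dy (component f k))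
      (component f' k).
    have := @C1_on_is_potential _ Omega (component f' k).
    have [C1f' _ _] := (C2_on_component f' oO).1 f'C k.
    move=> /(_ C1f') H p Op; have := H p Op.
    have gf := twin_sym (or_introl erefl) (fW p Op) (fg p Op) (fJ p Op).
    by have [-> ->] := gf k; have [-> ->] := gf' p Op k.
  have /choice[c Hc] k := potential_unique oO cO neO (pot k) (pot' k).
  exists (\row_k c k) => p Op; apply/rowP => k.
  by rewrite !mxE; exact: Hc.
Qed.
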